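(* For any $f\in\widetilde{H}_{p,q}$ and any vertex $\nu$ in $\Lambda_{(p,q)}$, we have $$\eta(f(\nu))=\psi(f)(\eta(\nu)).$$ Consequently, the action of $\widetilde{H}_{p,q}$ on $\Lambda_{(p,q)}$ and the action of $\mathrm{Aut}(\mathrm{coh}\text{-}\mathbb{X}(p,q))$ on $\mathcal{G}(\mathcal{T}^{\nu}_{\mathbb{X}})$ form a commutative diagram with the horizontal maps $\psi:\widetilde{H}_{p,q}\to\mathrm{Aut}(\mathrm{coh}\text{-}\mathbb{X}(p,q))$ and $\eta:\Lambda_{(p,q)}\to\mathcal{G}(\mathcal{T}^{\nu}_{\mathbb{X}})$, commutativity being in the sense of the displayed identity.
   Context: Sheaves. Let $\mathbf{k}$ be an algebraically closed field and $1\le p\le q$ integers. $\mathbb{L}(p,q)$ is the abelian group on generators $\vec{x}_1,\vec{x}_2$ with relation $p\vec{x}_1=q\vec{x}_2=:\vec{c}$. $S=\mathbf{k}[x_1,x_2]$ is $\mathbb{L}(p,q)$-graded with $\deg x_i=\vec{x}_i$. $\mathrm{coh}\text{-}\mathbb{X}(p,q)$ is the quotient of the category of finitely generated $\mathbb{L}(p,q)$-graded $S$-modules by the Serre subcategory of finite dimensional modules; $\mathcal{O}$ is the image of $S$ and $(\vec{x})$ denotes grading shift by $\vec{x}$. The indecomposable vector bundles are exactly the line bundles $\mathcal{O}(\vec{x})$. A sheaf $T$ is tilting if $\mathrm{Ext}^1(T,T)=0$ and $\mathrm{Hom}(T,X)=0=\mathrm{Ext}^1(T,X)$ implies $X=0$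 (tilting sheaves are taken multiplicity-free and up to isomorphism). A tilting bundle is a tilting sheaf that is a vector bundle. $\mathcal{G}(\mathcal{T}^{\nu}_{\mathbb{X}})$ is the graph whose vertices are the tilting bundles, with an edge between two of them iff they differ by precisely one indecomposable direct summand. $\mathrm{Aut}(\mathrm{coh}\text{-}\mathbb{X}(p,q))$ is the group of isomorphism classes of $\mathbf{k}$-linear self-equivalences; it acts on tilting bundles. The graph $\Lambda_{(p,q)}$ has vertex set $\Lambda^0_{(p,q)}=\{(c_1,\dots,c_p)\in\mathbb{Z}^p\mid c_1\le\cdots\le c_p\le c_1+q\}$, with an edge between $(c_1,\dots,c_p)$ and $(d_1,\dots,d_p)$ iff $\sum_{i=1}^p|c_i-d_i|=1$. The bijection $\eta=\varphi^{-1}:\Lambda_{(p,q)}\to\mathcal{G}(\mathcal{T}^{\nu}_{\mathbb{X}})$, an identification of graphs: in the strip $\mathbb{U}=\mathbb{R}\times[0,1]$ let $D^{i/p}_{j/q}$ be the arc from $(\tfrac{j}{q},0)$ to $(\tfrac{i}{p},1)$, associated with $\mathcal{O}(i\vec{x}_1-j\vec{x}_2)$. For a tilting bundle $T$, the set $\Gamma_T$ of all arcs $D^{i/p}_{j/q}$ with $\mathcal{O}(i\vec{x}_1-j\vec{x}_2)$ a summand of $T$ is a triangulation of $\mathbb{U}$ invariant under $(x,y)\mapsto(x+1,y)$. For $1\le i\le p$ the segment from $(\tfrac{i-1}{p},1)$ to $(\tfrac{i}{p},1)$ lies in a unique triangle of $\Gamma_T$, with third vertex $(\tfrac{c_i}{q},0)$;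 $\varphi(T)=(c_1,\dots,c_p)$. Groups and actions. $H_{p,q}=\langle r_1,r_2\mid r_1r_2=r_2r_1,\ r_1^p=r_2^q\rangle$; $\widetilde{H}_{p,q}=H_{p,q}$ if $p\ne q$, and $\widetilde{H}_{p,q}=H_{p,q}\times\mathbb{Z}_2$ if $p=q$, where $\sigma$ denotes the generator (involution) of $\mathbb{Z}_2$. The group $\widetilde{H}_{p,q}$ acts on $\Lambda_{(p,q)}$ by: $r_1$ acts as $(c_1,\dots,c_p)\mapsto(c_p-q,c_1,\dots,c_{p-1})$; $r_2$ acts as $(c_1,\dots,c_p)\mapsto(c_1-1,\dots,c_p-1)$; and for $p=q$, $\sigma$ acts as the involution $\rho$ defined as follows: given $(c_1,\dots,c_p)=\varphi(T)$, let $\Gamma'$ be the image of $\Gamma_T$ under $(x,y)\mapsto(-x,1-y)$; then $\rho(c_1,\dots,c_p)=(d_1,\dots,d_p)$, where $(\tfrac{d_i}{p},0)$ is the third vertex of the unique triangle of $\Gamma'$ containing the segment from $(\tfrac{i-1}{p},1)$ to $(\tfrac{i}{p},1)$. The map $\psi:\widetilde{H}_{p,q}\to\mathrm{Aut}(\mathrm{coh}\text{-}\mathbb{X}(p,q))$ is the group isomorphism sending $r_1\mapsto(\vec{x}_1)$, $r_2\mapsto(\vec{x}_2)$ and, if $p=q$, $\sigma\mapsto\sigma_{1,2}$, the self-equivalence induced by exchanging the two exceptional points $\infty$ and $0$, with $\mathcal{O}(l_1\vec{x}_1+l_2\vec{x}_2+l\vec{c})\mapsto\mathcal{O}(l_1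\vec{x}_2+l_2\vec{x}_1+l\vec{c})$.
   Formalization: For p=q the direct product H×Z_2 is replaced by the semidirect product with σr_1=r_2σ, since for p=q≥2 σ_{1,2} and ρ do not commute with the images of r_1, so ψ and the action would not exist; ψ is only assumed a homomorphism with the given values, not an isomorphism. *)

(* Defs.v *)
From HB Require Import structures.
From mathcomp Require Import all_boot all_order all_algebra all_fingroup.
From mathcomp Require Import generic_quotient ring_quotient.
From mathcomp Require Import boolp.
From mathcomp Require Import mpoly.

Set Implicit Arguments.
Unset Strict Implicit.
Unset Printing Implicit Defensive.

Import Order.TTheory GRing.Theory Num.Theory.
Local Open Scope ring_scope.
Local Open Scope quotient_scope.

(* Equality of morphisms is the relation [heq]. *)
Record lincat (k : fieldType) := LinCat {
  ob :> Type;
  hom : ob -> ob -> Type;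
  heq : forall A B, hom A B -> hom A B -> Prop;
  idm : forall A, hom A A;
  hcomp : forall A B C, hom B C -> hom A B -> hom A C;
  hzero : forall A B, hom A B;
  hadd : forall A B, hom A B -> hom A B -> hom A B;
  hscale : forall A B, k -> hom A B -> hom A B;
  heq_refl : forall A B (f : hom A B), heq f f;
  heq_sym : forall A B (f g : hom A B), heq f g -> heq g f;
  heq_trans : forall A B (f g h : hom A B), heq f g -> heq g h -> heq f h;
  hcomp_eq : forall A B C (g g' : hom B C) (f f' : hom A B),
    heq g g' -> heq f f' -> heq (hcomp g f) (hcomp g' f');
  hcompA : forall A B C D (h : hom C D) (g : hom B C) (f : hom A B),
    heq (hcomp h (hcomp g f)) (hcomp (hcomp h g) f);
  hcomp1f : forall A B (f : hom A B), heq (hcomp (idm B) f) f;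
  hcompf1 : forall A B (f : hom A B), heq (hcomp f (idm A)) f;
  hadd_eq : forall A B (f f' g g' : hom A B),
    heq f f' -> heq g g' -> heq (hadd f g) (hadd f' g');
  haddA : forall A B (f g h : hom A B),
    heq (hadd f (hadd g h)) (hadd (hadd f g) h);
  haddC : forall A B (f g : hom A B), heq (hadd f g) (hadd g f);
  hadd0f : forall A B (f : hom A B), heq (hadd (hzero A B) f) f;
  haddNf : forall A B (f : hom A B), heq (hadd (hscale (-1) f) f) (hzero A B);
  hscale_eq : forall A B c (f g : hom A B),
    heq f g -> heq (hscale c f) (hscale c g);
  hscaleA : forall A B c d (f : hom A B),
    heq (hscale c (hscale d f)) (hscale (c * d) f);
  hscale1 : forall A B (f : hom A B), heq (hscale 1 f) f;
  hscaleDr : forall A B c (f g : hom A B),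
    heq (hscale c (hadd f g)) (hadd (hscale c f) (hscale c g));
  hscaleDl : forall A B c d (f : hom A B),
    heq (hscale (c + d) f) (hadd (hscale c f) (hscale d f));
  hcompDr : forall A B C (h : hom B C) (f g : hom A B),
    heq (hcomp h (hadd f g)) (hadd (hcomp h f) (hcomp h g));
  hcompDl : forall A B C (g h : hom B C) (f : hom A B),
    heq (hcomp (hadd g h) f) (hadd (hcomp g f) (hcomp h f));
  hcompZr : forall A B C c (g : hom B C) (f : hom A B),
    heq (hcomp g (hscale c f)) (hscale c (hcomp g f));
  hcompZl : forall A B C c (g : hom B C) (f : hom A B),
    heq (hcomp (hscale c g) f) (hscale c (hcomp g f))
}.

Arguments idm {k} _ A.
Arguments hom {k} _ A B.
Arguments heq {k _ A B} f g.
Arguments hcomp {k _ A B C} g f.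
Arguments hzero {k _ A B}.
Arguments hadd {k _ A B} f g.
Arguments hscale {k _ A B} c f.

Declare Scope cat_scope.
Delimit Scope cat_scope with cat.
Local Open Scope cat_scope.
Notation "f ≈ g" := (heq f g) (at level 70, no associativity) : cat_scope.
Notation "g ∘ f" := (hcomp g f) (at level 40, left associativity) : cat_scope.

#[local] Obligation Tactic := idtac.

Section Categories.
Variable k : fieldType.
Implicit Types C D E : lincat k.

Definition iso C (A B : C) : Prop :=
  exists (f : hom C A B) (g : hom C B A), g ∘ f ≈ idm C A /\ f ∘ g ≈ idm C B.

Definition is_zero C (A : C) : Prop := idm C A ≈ hzero.

Definition hom_zero C (A B : C) : Prop := forall f : hom C A B, f ≈ hzero.

Definition direct_sum C (I : finType) (X : C) (A : I -> C) : Prop :=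
  exists (inj : forall i, hom C (A i) X) (prj : forall i, hom C X (A i)),
    [/\ forall i, prj i ∘ inj i ≈ idm C (A i),
        forall i j, i != j -> prj j ∘ inj i ≈ hzero &
        \big[hadd/hzero]_(i : I) (inj i ∘ prj i) ≈ idm C X].

Definition direct_sum2 C (X A B : C) : Prop :=
  direct_sum X (fun b : bool => if b then A else B).

Definition summand C (A X : C) : Prop := exists B, direct_sum2 X A B.

Definition indecomposable C (X : C) : Prop :=
  ~ is_zero X /\ forall A B, direct_sum2 X A B -> is_zero A \/ is_zero B.

(* a sum of pairwise non-isomorphic indecomposable objects *)
Definition multiplicity_free C (X : C) : Prop :=
  exists (n : nat) (A : 'I_n -> C),
    [/\ forall i, indecomposable (A i),
        forall i j, i != j -> ~ iso (A i) (A j) &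
        direct_sum X A].

Definition is_kernel C (A B D : C) (f : hom C A B) (g : hom C B D) : Prop :=
  g ∘ f ≈ hzero /\
  forall (X : C) (h : hom C X B), g ∘ h ≈ hzero ->
    exists u : hom C X A, f ∘ u ≈ h /\ forall v, f ∘ v ≈ h -> v ≈ u.

Definition is_cokernel C (A B D : C) (f : hom C A B) (g : hom C B D) : Prop :=
  g ∘ f ≈ hzero /\
  forall (X : C) (h : hom C B X), h ∘ f ≈ hzero ->
    exists u : hom C D X, u ∘ g ≈ h /\ forall v, v ∘ g ≈ h -> v ≈ u.

Definition short_exact C (A B D : C) (f : hom C A B) (g : hom C B D) : Prop :=
  is_kernel f g /\ is_cokernel f g.

(* Yoneda Ext^1 of D by A is zero: every extension of D by A splits. *)
Definition ext1_zero C (D A : C) : Prop :=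
  forall (B : C) (f : hom C A B) (g : hom C B D), short_exact f g ->
    exists s : hom C D B, g ∘ s ≈ idm C D.

Definition tilting C (T : C) : Prop :=
  [/\ multiplicity_free T,
      ext1_zero T T &
      forall X : C, hom_zero T X -> ext1_zero T X -> is_zero X].

Record functor C D := Functor {
  fob :> C -> D;
  fmap : forall A B, hom C A B -> hom D (fob A) (fob B);
  fmap_eq : forall A B (f g : hom C A B), f ≈ g -> fmap f ≈ fmap g;
  fmap1 : forall A, fmap (idm C A) ≈ idm D (fob A);
  fmap_comp : forall A B X (g : hom C B X) (f : hom C A B),
    fmap (g ∘ f) ≈ fmap g ∘ fmap f;
  fmapD : forall A B (f g : hom C A B),
    fmap (hadd f g) ≈ hadd (fmap f) (fmap g);
  fmapZ : forall A B c (f : hom C A B), fmap (hscale c f) ≈ hscale c (fmap f)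
}.

Arguments fmap {C D} F {A B} f : rename.

Program Definition fid C : functor C C :=
  @Functor C C (fun A => A) (fun A B f => f) _ _ _ _ _.
Next Obligation. by []. Qed.
Next Obligation. by move=> *; apply: heq_refl. Qed.
Next Obligation. by move=> *; apply: heq_refl. Qed.
Next Obligation. by move=> *; apply: heq_refl. Qed.
Next Obligation. by move=> *; apply: heq_refl. Qed.

Program Definition fcomp C D E (G : functor D E) (F : functor C D) :
    functor C E :=
  @Functor C E (fun A => G (F A)) (fun A B f => fmap G (fmap F f)) _ _ _ _ _.
Next Obligation.
by move=> C D E G F A B f g fg; apply/fmap_eq/fmap_eq.
Qed.
Next Obligation.
move=> C D E G F A; apply: heq_trans (fmap1 G _).
by apply/fmap_eq/fmap1.
Qed.
Next Obligation.
move=> C D E G F A B X g f; apply: heq_trans (fmap_comp G _ _).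
by apply/fmap_eq/fmap_comp.
Qed.
Next Obligation.
move=> C D E G F A B f g; apply: heq_trans (fmapD G _ _).
by apply/fmap_eq/fmapD.
Qed.
Next Obligation.
move=> C D E G F A B c f; apply: heq_trans (fmapZ G _ _).
by apply/fmap_eq/fmapZ.
Qed.

Definition natiso C D (F G : functor C D) : Prop :=
  exists (a : forall A, hom D (F A) (G A)) (b : forall A, hom D (G A) (F A)),
    (forall A, b A ∘ a A ≈ idm D (F A) /\ a A ∘ b A ≈ idm D (G A)) /\
    (forall A B (f : hom C A B), a B ∘ fmap F f ≈ fmap G f ∘ a A).

(* The elements of Aut(C) are self-equivalences, their equality is [natiso]. *)
Record selfequiv C := SelfEquiv {
  se_fun :> functor C C;
  se_inv : exists G : functor C C,
    natiso (fcomp G se_fun) (fid C) /\ natiso (fcomp se_fun G) (fid C)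
}.

End Categories.

Definition Lrel (p q : nat) : {pred int * int} :=
  fun v : int * int => `[< exists n : int, v = (p%:Z * n, - (q%:Z * n)) >].

Fact Lrel_zmod p q : zmod_closed (Lrel p q).
Proof.
split=> [|u v]; first by apply/asboolP; exists 0; rewrite !mulr0 oppr0.
move=> /asboolP[a ->] /asboolP[b ->]; apply/asboolP; exists (a - b).
by rewrite !mulrBr opprB; congr (_, _); rewrite /= opprK addrC.
Qed.

HB.instance Definition _ p q :=
  GRing.isZmodClosed.Build (int * int)%type (Lrel p q) (Lrel_zmod p q).

Definition L (p q : nat) : zmodType := @Quotient.quot (int * int)%type (Lrel p q).

(* the class of a x1 + b x2 *)
Definition piL p q (v : int * int) : L p q :=
  \pi_(@Quotient.quot (int * int)%type (Lrel p q)) v.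

Definition x1 p q : L p q := piL p q (1, 0).
Definition x2 p q : L p q := piL p q (0, 1).

Section Graded.
Variables (k : fieldType) (p q : nat).
Local Notation S := {mpoly k[2]}.
Local Notation L := (L p q).

Definition degL (m : 'X_{1..2}) : L :=
  x1 p q *+ m ord0 + x2 p q *+ m ord_max.

(* the homogeneous component S_x; the variables x1, x2 are 'X_0, 'X_1 *)
Definition homogS (x : L) (f : S) : bool :=
  all (fun m => degL m == x) (msupp f).

(* A graded S-module: the decomposition of M as the direct sum of its        *)
(* components M_x is given by the projections [gpart x] of M onto M_x.       *)
Record gmodule := GModule {
  gcar :> lmodType S;
  gpart : L -> gcar -> gcar;
  gpartB : forall x m n, gpart x (m - n) = gpart x m - gpart x n;
  gpartK : forall x y m,
    gpart x (gpart y m) = if x == y then gpart x m else 0;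
  gpart_sum : forall m, exists2 s : seq L,
    uniq s & m = \sum_(x <- s) gpart x m;
  gpart_scale : forall x y f m, homogS x f -> gpart y m = m ->
    gpart (x + y) (f *: m) = f *: m
}.

Arguments gpart : clear implicits.

Definition fin_gen (M : lmodType S) : Prop :=
  exists (n : nat) (e : 'I_n -> M),
    forall m, exists a : 'I_n -> S, m = \sum_i a i *: e i.

(* m is a k-linear combination of the elements of s *)
Fixpoint kspan (M : lmodType S) (s : seq M) (m : M) : Prop :=
  if s is e :: s' then exists c : k, kspan s' (m - c%:MP *: e) else m = 0.

(* for a subspace P of M: P is finite dimensional *)
Definition findim (M : lmodType S) (P : M -> Prop) : Prop :=
  exists s : seq M, forall m, P m -> kspan s m.

(* for a subspace P of M: M / P is finite dimensional *)
Definition cofindim (M : lmodType S) (P : M -> Prop) : Prop :=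
  exists s : seq M, forall m, exists2 n, P n & kspan s (m - n).

Definition ksub (M : lmodType S) (P : M -> Prop) : Prop :=
  [/\ P 0, forall a b, P a -> P b -> P (a + b)
    & forall (c : k) a, P a -> P (c%:MP *: a)].

Section KSpan.
Variable M : lmodType S.
Implicit Types (m n : M) (s t : seq M).

Lemma kspan0 s : kspan s 0.
Proof. by elim: s => //= e s IH; exists 0; rewrite scale0r subr0. Qed.

Lemma kspanD s m n : kspan s m -> kspan s n -> kspan s (m + n).
Proof.
elim: s m n => [m n /= -> ->|e s IH m n /= [c hm] [d hn]]; first by rewrite addr0.
by exists (c + d); rewrite mpolyCD scalerDl opprD addrACA; apply: IH.
Qed.

Lemma kspanZ s (c : k) m : kspan s m -> kspan s (c%:MP *: m).
Proof.
elim: s m => [m /= ->|e s IH m /= [d hm]]; first by rewrite scaler0.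
by exists (c * d); rewrite mpolyCM -scalerA -scalerBr; apply: IH.
Qed.

Lemma kspan_cat s t m n : kspan s m -> kspan t n -> kspan (s ++ t) (m + n).
Proof.
elim: s m => [m /= -> ht|e s IH m /= [c hm] ht]; first by rewrite add0r.
by exists c; rewrite addrAC; apply: IH.
Qed.

Lemma kspan_ksub s : ksub (kspan s).
Proof.
by split; [exact: kspan0|move=> a b; apply: kspanD|move=> c a; apply: kspanZ].
Qed.

Lemma ksubB (P : M -> Prop) a b : ksub P -> P a -> P b -> P (a - b).
Proof.
move=> [P0 PD PZ] Pa Pb; apply: PD => //.
by rewrite -[- b]scaleN1r -(mpolyC1 2 k) -mpolyCN; apply: PZ.
Qed.

Lemma ksub_kspan (P : M -> Prop) s m :
  ksub P -> {in s, forall e, P e} -> kspan s m -> P m.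
Proof.
move=> subP; have [P0 PD PZ] := subP.
elim: s m => [m _ /= -> //|e s IH m sP /= [c hm]].
rewrite -[m](subrK (c%:MP *: e)); apply: PD.
  by apply: IH => // x xs; apply: sP; rewrite inE xs orbT.
by apply/PZ/sP; rewrite inE eqxx.
Qed.

Lemma fin_mod (U K : M -> Prop) s : ksub U -> ksub K ->
    (forall u, U u -> exists2 w, kspan s w & K (u - w)) ->
  exists2 t, {in t, forall e, U e} &
    forall u, U u -> exists2 w, kspan t w & K (u - w).
Proof.
move=> subU subK; have [K0 KD KZ] := subK.
elim: s U subU => [|e s IH] U subU sU.
  by exists [::] => // u /sU[w /= -> Ku]; exists 0.
have [U0 UD UZ] := subU.
pose U' u := U u /\ exists2 w, kspan s w & K (u - w).
have subU' : ksub U'.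
  split=> [|a b [Ua [w sw Kw]] [Ub [w' sw' Kw']]|c a [Ua [w sw Kw]]].
  - by split=> //; exists 0; [exact: kspan0|rewrite subr0].
  - split; first exact: UD.
    by exists (w + w'); [apply: kspanD|rewrite opprD addrACA; apply: KD].
  - split; first exact: UZ.
    by exists (c%:MP *: w); [apply: kspanZ|rewrite -scalerBr; apply: KZ].
have [t tU' ht] : exists2 t, {in t, forall e, U' e} &
    forall u, U' u -> exists2 w, kspan t w & K (u - w).
  by apply: IH => // u [].
have [allU'|] := pselect (forall u, U u -> U' u).
  by exists t => [x /tU'[]//|u /allU'/ht].
move=> /existsNP[u0 /not_implyP[Uu0 nU'u0]].
have [w0 [c0 sw0] Kw0] := sU _ Uu0.
have c0_neq0 : c0 != 0.
  apply: contra_notN nU'u0 => /eqP c00; split=> //; exists w0 => //.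
  by move: sw0; rewrite c00 scale0r subr0.
exists (u0 :: t) => [x|u Uu].
  by rewrite inE => /orP[/eqP->//|/tU'[]].
have [w [c sw] Kw] := sU _ Uu.
pose d := c / c0; pose u' := u - d%:MP *: u0.
have [|v tv Kv] := ht u'.
  split; first by apply: ksubB => //; apply: UZ.
  exists (w - d%:MP *: w0).
    have -> : w - d%:MP *: w0 = (w - c%:MP *: e) - d%:MP *: (w0 - c0%:MP *: e).
      rewrite scalerBr scalerA -mpolyCM /d divfK //.
      by rewrite opprB addrA subrK.
    by apply: ksubB; [exact: kspan_ksub| |apply: kspanZ].
  have -> : u' - (w - d%:MP *: w0) = (u - w) - d%:MP *: (u0 - w0).
    by rewrite /u' scalerBr !opprD !opprK addrACA.
  by apply: ksubB => //; apply: KZ.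
exists (v + d%:MP *: u0); first by exists d; rewrite addrK.
by rewrite opprD addrA addrAC.
Qed.

End KSpan.

Lemma kspan_map (M N : lmodType S) (f : M -> N) s m :
    f 0 = 0 -> (forall (c : k) a b, f (a - c%:MP *: b) = f a - c%:MP *: f b) ->
  kspan s m -> kspan (map f s) (f m).
Proof.
move=> f0 fB; elim: s m => [m /= ->//|e s IH m /= [c hm]].
by exists c; rewrite -fB; apply: IH.
Qed.

Lemma findimS (M : lmodType S) (P Q : M -> Prop) :
  (forall m, P m -> Q m) -> findim Q -> findim P.
Proof. by move=> PQ [s hs]; exists s => m /PQ/hs. Qed.

Lemma findimD (M : lmodType S) (P Q : M -> Prop) : findim P -> findim Q ->
  findim (fun m => exists a b, [/\ P a, Q b & m = a + b]).
Proof.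
move=> [s hs] [t ht]; exists (s ++ t) => m [a [b [/hs sa /ht tb ->]]].
exact: kspan_cat.
Qed.

Lemma cofindimS (M : lmodType S) (P Q : M -> Prop) :
  (forall m, P m -> Q m) -> cofindim P -> cofindim Q.
Proof. by move=> PQ [s hs]; exists s => m; have [n /PQ] := hs m; exists n. Qed.

Lemma fin_cofin (M N : lmodType S) (U : M * N -> Prop) (P : M -> Prop) :
    ksub U -> ksub P -> cofindim P ->
  exists2 t, {in t, forall e, U e} &
    forall u, U u -> exists2 w, kspan t w & P (u - w).1.
Proof.
move=> subU [P0 PD PZ] [s hs].
apply: (@fin_mod _ U (fun u => P u.1) [seq (e, 0) | e <- s]) => //.
  by split=> //= *; [apply: PD|apply: PZ].
move=> u _; have [n Pn sn] := hs u.1; exists (u.1 - n, 0).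
  apply: (@kspan_map _ _ (fun e => (e, 0))) sn => // c a b.
  by congr (_, _); rewrite /= scaler0 subrr.
by rewrite /= opprB addrC subrK.
Qed.

Lemma findim_cofin (M N : lmodType S) (U : M * N -> Prop) (P : M -> Prop) :
    ksub U -> ksub P -> cofindim P ->
    findim (fun d => exists2 m, P m & U (m, d)) ->
  findim (fun d => exists m, U (m, d)).
Proof.
move=> subU subP cofP [s hs]; have [t tU ht] := fin_cofin subU subP cofP.
exists (map snd t ++ s) => d [m Umd]; have [w tw Pw] := ht _ Umd.
rewrite -[d](subrK w.2) addrC; apply: kspan_cat.
  exact: (@kspan_map _ _ snd).
apply: hs; exists (m - w.1) => //.
have -> : (m - w.1, d - w.2) = (m, d) - w by [].
by apply: ksubB => //; apply: (ksub_kspan subU tU tw).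
Qed.

Lemma cofindim_pre (M N : lmodType S) (U : M * N -> Prop) (P : N -> Prop) :
    ksub U -> ksub P -> cofindim P ->
    cofindim (fun m => exists n, U (m, n)) ->
  cofindim (fun m => exists2 n, P n & U (m, n)).
Proof.
move=> [U0 UD UZ] subP cofP [s hs].
pose U' (v : N * M) := U (v.2, v.1).
have subU' : ksub U'.
  by split=> [//|a b|c a]; rewrite /U' /=; [apply: UD|apply: UZ].
have [t tU ht] := fin_cofin subU' subP cofP.
exists (s ++ map snd t) => m; have [m1 [n1 Umn] sm] := hs m.
have [w tw Pw] := ht (n1, m1) Umn.
exists (m1 - w.2).
  exists (n1 - w.1) => //.
  have : U' ((n1, m1) - w) by apply: ksubB => //; apply: (ksub_kspan subU' tU tw).
  by [].
rewrite opprB addrCA addrC; apply: kspan_cat => //.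
exact: (@kspan_map _ _ snd).
Qed.

Lemma cofindimI (M : lmodType S) (P Q : M -> Prop) : ksub P -> ksub Q ->
  cofindim P -> cofindim Q -> cofindim (fun m => P m /\ Q m).
Proof.
move=> subP subQ cofP cofQ.
have [P0 PD PZ] := subP.
have := @cofindim_pre M M (fun v => v.1 = v.2 /\ P v.1) Q _ subQ cofQ.
case.
- by split=> //= [[a a'] [b b'] [/= -> Pa] [/= -> Pb]|c [a a'] [/= -> Pa]];
    split=> //=; [apply: PD|apply: PZ].
- by apply: cofindimS cofP => m Pm; exists m.
move=> s hs; exists s => m; have [n [n' Qn [/= nn' Pn]] sn] := hs m.
by exists n => //; split=> //; rewrite nn'.
Qed.

(* The quotient of the category of graded modules by the finite dimensional  *)
(* ones. Gabriel's description of Hom(M, N) is the colimit of the spaces of  *)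
(* degree 0 homomorphisms M' -> N / N', where M' <= M and N' <= N are graded *)
(* submodules with M / M' and N' finite dimensional. Such a homomorphism is  *)
(* recorded by the set of the pairs (m, n) with m in M' and n in its image,  *)
(* which is a graded submodule of M (+) N.                                   *)

Record qhom (M N : gmodule) := QHom {
  qrel : M -> N -> Prop;
  qrel0 : qrel 0 0;
  qrelD : forall m m' n n', qrel m n -> qrel m' n' -> qrel (m + m') (n + n');
  qrelZ : forall (f : S) m n, qrel m n -> qrel (f *: m) (f *: n);
  qrel_part : forall x m n, qrel m n -> qrel (gpart M x m) (gpart N x n);
  qrel_dom : cofindim (fun m => exists n, qrel m n);
  qrel_ind : findim (fun n => qrel 0 n)
}.

(* f : M' -> N / N' and f'' : M'' -> N / N'' satisfy M'' <= M', N' <= N'',   *)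
(* and f'' is induced by f *)
Definition qrefine (M N : gmodule) (f f'' : qhom M N) : Prop :=
  (forall m n'', qrel f'' m n'' -> exists n, qrel f m n) /\
  (forall m n n'', qrel f m n -> qrel f'' m n'' -> qrel f'' m n).

(* equality in the colimit *)
Definition qeq (M N : gmodule) (f f' : qhom M N) : Prop :=
  exists f'', qrefine f f'' /\ qrefine f' f''.

Section QHomTheory.
Variables M N : gmodule.
Implicit Types f g h : qhom M N.

Lemma qrelN f m n : qrel f m n -> qrel f (- m) (- n).
Proof. by move=> fmn; rewrite -scaleN1r -[- n]scaleN1r; apply: qrelZ. Qed.

Lemma qrelB f m m' n n' :
  qrel f m n -> qrel f m' n' -> qrel f (m - m') (n - n').
Proof. by move=> fmn /qrelN; apply: qrelD. Qed.

Lemma ksub_graph f : ksub (fun v : M * N => qrel f v.1 v.2).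
Proof.
by split=> [|a b|c a]; [exact: qrel0|exact: qrelD|exact: qrelZ].
Qed.

Lemma ksub_dom f : ksub (fun m => exists n, qrel f m n).
Proof.
split=> [|a b [n fn] [n' fn']|c a [n fn]].
- by exists 0; apply: qrel0.
- by exists (n + n'); apply: qrelD.
- by exists (c%:MP *: n); apply: qrelZ.
Qed.

Lemma ksub_ind f : ksub (fun n => qrel f 0 n).
Proof.
split=> [|a b fa fb|c a fa]; first exact: qrel0.
  by rewrite -[0]addr0; apply: qrelD.
by rewrite -[0](scaler0 _ (c%:MP)); apply: qrelZ.
Qed.

Definition qdiff f g (d : N) : Prop :=
  exists m n n', [/\ qrel f m n, qrel g m n' & d = n - n'].

Lemma ksub_qdiff2 f g : ksub (fun v : M * N =>
  exists n n', [/\ qrel f v.1 n, qrel g v.1 n' & v.2 = n - n']).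
Proof.
split=> [|a b [n [n' [fn gn ea]]] [r [r' [fr gr eb]]]|c a [n [n' [fn gn ea]]]] /=.
- by exists 0, 0; split; [exact: qrel0|exact: qrel0|rewrite subrr].
- exists (n + r), (n' + r'); rewrite ea eb.
  by split; [exact: qrelD|exact: qrelD|rewrite opprD addrACA].
- exists (c%:MP *: n), (c%:MP *: n'); rewrite ea.
  by split; [exact: qrelZ|exact: qrelZ|rewrite scalerBr].
Qed.

Lemma qdiff_cofin f g (P : M -> Prop) : ksub P -> cofindim P ->
    findim (fun d => exists m n n',
      [/\ P m, qrel f m n, qrel g m n' & d = n - n']) ->
  findim (qdiff f g).
Proof.
move=> subP cofP finP.
apply: (findimS _ (findim_cofin (ksub_qdiff2 f g) subP cofP _)).
  by move=> d [m [n [n' [fn gn ->]]]]; exists m, n, n'.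
by apply: findimS finP => d [m Pm [n [n' [fn gn /= ->]]]]; exists m, n, n'.
Qed.

Lemma qdom_int f g :
  cofindim (fun m => (exists n, qrel f m n) /\ (exists n, qrel g m n)).
Proof. by apply: cofindimI; try exact: ksub_dom; apply: qrel_dom. Qed.

Section Common.
Variables f g : qhom M N.
Hypothesis fin_fg : findim (qdiff f g).

Definition qcommon_rel m n := exists n1 d,
  [/\ qrel f m n1, exists n2, qrel g m n2, qdiff f g d & n = n1 + d].

Program Definition qcommon : qhom M N := @QHom M N qcommon_rel _ _ _ _ _ _.
Next Obligation.
exists 0, 0; split; rewrite ?addr0 //; first exact: qrel0.
  by exists 0; apply: qrel0.
by exists 0, 0, 0; rewrite subr0; split=> //; apply: qrel0.
Qed.
Next Obligation.
move=> m m' n n' [n1 [d [fn1 [n2 gn2] [a [b [c [fb gc ->]]]] ->]]].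
move=> [n1' [d' [fn1' [n2' gn2'] [a' [b' [c' [fb' gc' ->]]]] ->]]].
exists (n1 + n1'), (b - c + (b' - c')); split; first exact: qrelD.
- by exists (n2 + n2'); apply: qrelD.
- exists (a + a'), (b + b'), (c + c').
  by split; [exact: qrelD|exact: qrelD|rewrite opprD addrACA].
- by rewrite addrACA.
Qed.
Next Obligation.
move=> s m n [n1 [d [fn1 [n2 gn2] [a [b [c [fb gc ->]]]] ->]]].
exists (s *: n1), (s *: (b - c)); split; first exact: qrelZ.
- by exists (s *: n2); apply: qrelZ.
- exists (s *: a), (s *: b), (s *: c).
  by split; [exact: qrelZ|exact: qrelZ|rewrite scalerBr].
- by rewrite scalerDr.
Qed.
Next Obligation.
move=> x m n [n1 [d [fn1 [n2 gn2] [a [b [c [fb gc ->]]]] ->]]].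
have partD (u v : N) : gpart N x (u + v) = gpart N x u + gpart N x v.
  have part0 : gpart N x 0 = 0 by rewrite -[0 in LHS](subrr 0) gpartB subrr.
  by rewrite -{1}[v]opprK -[- v]sub0r !gpartB part0 opprB subr0.
exists (gpart N x n1), (gpart N x (b - c)); split; first exact: qrel_part.
- by exists (gpart N x n2); apply: qrel_part.
- exists (gpart M x a), (gpart N x b), (gpart N x c).
  by split; [exact: qrel_part|exact: qrel_part|rewrite gpartB].
- by rewrite partD.
Qed.
Next Obligation.
apply: cofindimS (qdom_int f g) => m [[n fn] [n' gn']].
exists n, n, 0; split; rewrite ?addr0 //; first by exists n'.
by exists 0, 0, 0; rewrite subr0; split=> //; apply: qrel0.
Qed.
Next Obligation.
apply: findimS (findimD (qrel_ind f) fin_fg).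
by move=> n [n1 [d [fn1 _ dd ->]]]; exists n1, d.
Qed.

End Common.

Lemma qeqP f g : qeq f g <-> findim (qdiff f g).
Proof.
split=> [[h [[hf1 hf2] [hg1 hg2]]]|fin_fg].
  apply: (qdiff_cofin (ksub_dom h) (qrel_dom h)).
  apply: findimS (qrel_ind h) => d [m [n [n' [[r hr] fn gn ->]]]].
  by rewrite -(subrr m); apply: qrelB; [apply: hf2 hr|apply: hg2 hr].
exists (qcommon fin_fg); split; split=> m n.
- by move=> [n1 [d [fn1 _ _ _]]]; exists n1.
- move=> n'' fn [n1 [d [fn1 gn2 _ _]]]; exists n, 0.
  split=> //; last by rewrite addr0.
  by exists 0, 0, 0; rewrite subr0; split=> //; apply: qrel0.
- by move=> [n1 [d [_ [n2 gn2] _ _]]]; exists n2.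
- move=> n'' gn [n1 [d [fn1 gn2 _ _]]]; exists n1, (n - n1).
  split=> //; last by rewrite addrC subrK.
  exists (- m), (- n1), (- n).
  by split; [exact: qrelN|exact: qrelN|rewrite opprK addrC].
Qed.

Lemma qeq_incl f g : (forall m n, qrel f m n -> qrel g m n) -> qeq f g.
Proof.
move=> fg; apply/qeqP; apply: findimS (qrel_ind g) => d.
by move=> [m [n [n' [/fg gn gn' ->]]]]; rewrite -(subrr m); apply: qrelB.
Qed.

Lemma qeq_refl f : qeq f f. Proof. exact: qeq_incl. Qed.

Lemma qeq_sym f g : qeq f g -> qeq g f.
Proof. by move=> [h []]; exists h. Qed.

Lemma qeq_trans f g h : qeq f g -> qeq g h -> qeq f h.
Proof.
move=> /qeqP fg /qeqP gh; apply/qeqP.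
apply: (qdiff_cofin (ksub_dom g) (qrel_dom g)).
apply: findimS (findimD fg gh) => d [m [n [n' [[r gr] fn hn ->]]]].
exists (n - r), (r - n'); split; last by rewrite addrA subrK.
  by exists m, n, r.
by exists m, r, n'.
Qed.

End QHomTheory.

Lemma gpart0 (M : gmodule) x : gpart M x 0 = 0.
Proof. by rewrite -[0 in LHS](subrr 0) gpartB subrr. Qed.

Lemma gpartN (M : gmodule) x m : gpart M x (- m) = - gpart M x m.
Proof. by rewrite -sub0r gpartB gpart0 sub0r. Qed.

Lemma gpartD (M : gmodule) x m n :
  gpart M x (m + n) = gpart M x m + gpart M x n.
Proof. by rewrite -{1}[n]opprK gpartB gpartN opprK. Qed.

Lemma homogS_const (c : k) : homogS 0 c%:MP.
Proof.
rewrite /homogS msuppC; case: (c == 0) => //=.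
by rewrite andbT /degL !mnm0E !mulr0n addr0.
Qed.

Lemma gpart_const (M : gmodule) x (c : k) m :
  gpart M x (c%:MP *: m) = c%:MP *: gpart M x m.
Proof.
have part y z n : gpart M y n = n ->
    gpart M z (c%:MP *: n) = if z == y then c%:MP *: n else 0.
  move=> yn; have := gpart_scale (homogS_const c) yn; rewrite add0r => yc.
  by rewrite -yc gpartK; case: eqP => // ->.
have [s us ms] := gpart_sum m.
have sum (F : L -> M) z : gpart M z (\sum_(y <- s) F y) =
    \sum_(y <- s) gpart M z (F y).
  by elim: (s) => [|y t IH]; rewrite ?big_nil ?gpart0 // !big_cons gpartD IH.
rewrite [in LHS]ms scaler_sumr sum [in RHS]ms sum scaler_sumr.
apply: eq_bigr => y _; rewrite (part y) ?gpartK ?eqxx //.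
by case: eqP => [->|_]; rewrite ?scaler0.
Qed.

Program Definition qid (M : gmodule) : qhom M M :=
  @QHom M M (fun m n => m = n) _ _ _ _ _ _.
Next Obligation. by []. Qed.
Next Obligation. by move=> M m m' n n' -> ->. Qed.
Next Obligation. by move=> M f m n ->. Qed.
Next Obligation. by move=> M x m n ->. Qed.
Next Obligation.
by move=> M; exists [::] => m; exists m; [exists m|rewrite /= subrr].
Qed.
Next Obligation. by move=> M; exists [::] => m /= <-. Qed.

Program Definition qzero (M N : gmodule) : qhom M N :=
  @QHom M N (fun m n => n = 0) _ _ _ _ _ _.
Next Obligation. by []. Qed.
Next Obligation. by move=> M N m m' n n' -> ->; rewrite addr0. Qed.
Next Obligation. by move=> M N f m n ->; rewrite scaler0. Qed.
Next Obligation. by move=> M N x m n ->; rewrite gpart0. Qed.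
Next Obligation.
by move=> M N; exists [::] => m; exists m; [exists 0|rewrite /= subrr].
Qed.
Next Obligation. by move=> M N; exists [::] => m /= ->. Qed.

Lemma findim_image (M N : gmodule) (g : qhom M N) (P : M -> Prop) :
  ksub P -> findim P -> findim (fun l => exists2 n, P n & qrel g n l).
Proof.
move=> subP [s hs]; have [P0 PD PZ] := subP.
pose U (v : M * N) := P v.1 /\ qrel g v.1 v.2.
have [g0 gD gZ] := ksub_graph g.
have subU : ksub U.
  split=> [//|a b [Pa ga] [Pb gb]|c a [Pa ga]].
    by split; [apply: PD|apply: gD].
  by split; [apply: PZ|apply: gZ].
have [||t tU ht] := @fin_mod _ U (fun v => v.1 = 0) [seq (e, 0) | e <- s] subU.
- by split=> //= [a b -> ->|c a ->]; rewrite ?addr0 ?scaler0.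
- move=> u [/hs Pu _]; exists (u.1, 0); last by rewrite /= subrr.
  apply: (@kspan_map _ _ (fun e => (e, 0))) Pu => // c a b.
  by congr (_, _); rewrite /= scaler0 subrr.
have [r hr] := qrel_ind g.
exists (map snd t ++ r) => l [n Pn gnl].
have [w tw /= /eqP] := ht (n, l) (conj Pn gnl).
rewrite subr_eq0 => /eqP nw; rewrite -[l](subrK w.2) addrC.
apply: kspan_cat; first exact: (@kspan_map _ _ snd).
apply: hr; have [_ gw] := ksub_kspan subU tU tw.
by rewrite -(subrr w.1) -{1}nw; apply: qrelB.
Qed.

Program Definition qcomp (M N P : gmodule) (g : qhom N P) (f : qhom M N) :
    qhom M P :=
  @QHom M P (fun m l => exists2 n, qrel f m n & qrel g n l) _ _ _ _ _ _.
Next Obligation. by move=> M N P g f; exists 0; apply: qrel0. Qed.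
Next Obligation.
move=> M N P g f m m' l l' [n fn gn] [n' fn' gn'].
by exists (n + n'); apply: qrelD.
Qed.
Next Obligation.
by move=> M N P g f s m l [n fn gn]; exists (s *: n); apply: qrelZ.
Qed.
Next Obligation.
by move=> M N P g f x m l [n fn gn]; exists (gpart N x n); apply: qrel_part.
Qed.
Next Obligation.
move=> M N P g f.
apply: cofindimS (cofindim_pre (ksub_graph f) (ksub_dom g) (qrel_dom g) _).
  by move=> m [n [l gl] /= fn]; exists l, n.
exact: qrel_dom.
Qed.
Next Obligation.
move=> M N P g f; apply: findimS (findim_image g (ksub_ind f) (qrel_ind f)).
by move=> l [n fn gn]; exists n.
Qed.

Program Definition qadd (M N : gmodule) (f g : qhom M N) : qhom M N :=
  @QHom M N (fun m n => exists n1 n2,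
    [/\ qrel f m n1, qrel g m n2 & n = n1 + n2]) _ _ _ _ _ _.
Next Obligation.
by move=> M N f g; exists 0, 0; rewrite addr0; split=> //; apply: qrel0.
Qed.
Next Obligation.
move=> M N f g m m' n n' [a [b [fa gb ->]]] [a' [b' [fa' gb' ->]]].
exists (a + a'), (b + b').
by split; [exact: qrelD|exact: qrelD|rewrite addrACA].
Qed.
Next Obligation.
move=> M N f g s m n [a [b [fa gb ->]]]; exists (s *: a), (s *: b).
by split; [exact: qrelZ|exact: qrelZ|rewrite scalerDr].
Qed.
Next Obligation.
move=> M N f g x m n [a [b [fa gb ->]]]; exists (gpart N x a), (gpart N x b).
by split; [exact: qrel_part|exact: qrel_part|rewrite gpartD].
Qed.
Next Obligation.
move=> M N f g; apply: cofindimS (qdom_int f g) => m [[n fn] [n' gn]].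
by exists (n + n'), n, n'.
Qed.
Next Obligation.
move=> M N f g; apply: findimS (findimD (qrel_ind f) (qrel_ind g)).
by move=> n [a [b [fa gb ->]]]; exists a, b.
Qed.

Program Definition qscale (M N : gmodule) (c : k) (f : qhom M N) : qhom M N :=
  @QHom M N (fun m n => exists2 n1, qrel f m n1 & n = c%:MP *: n1) _ _ _ _ _ _.
Next Obligation.
by move=> M N c f; exists 0; [exact: qrel0|rewrite scaler0].
Qed.
Next Obligation.
move=> M N c f m m' n n' [a fa ->] [a' fa' ->].
by exists (a + a'); [exact: qrelD|rewrite scalerDr].
Qed.
Next Obligation.
move=> M N c f s m n [a fa ->]; exists (s *: a); first exact: qrelZ.
by rewrite !scalerA mulrC.
Qed.
Next Obligation.
move=> M N c f x m n [a fa ->].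
by exists (gpart N x a); [exact: qrel_part|rewrite gpart_const].
Qed.
Next Obligation.
move=> M N c f; apply: cofindimS (qrel_dom f) => m [n fn].
by exists (c%:MP *: n), n.
Qed.
Next Obligation.
move=> M N c f; have [s hs] := qrel_ind f; exists s => n [a /hs sa ->].
exact: kspanZ.
Qed.

Lemma qcomp_eq (M N P : gmodule) (g g' : qhom N P) (f f' : qhom M N) :
  qeq g g' -> qeq f f' -> qeq (qcomp g f) (qcomp g' f').
Proof.
move=> /qeqP gg' /qeqP ff'.
apply: (@qeq_trans _ _ _ (qcomp g f')).
  have subD : ksub (qdiff f f').
    split=> [|a b [m [n [r [fn fr ->]]]] [m' [n' [r' [fn' fr' ->]]]]|].
    - by exists 0, 0, 0; rewrite subrr; split=> //; apply: qrel0.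
    - exists (m + m'), (n + n'), (r + r').
      by split; [exact: qrelD|exact: qrelD|rewrite opprD addrACA].
    - move=> c a [m [n [r [fn fr ->]]]].
      exists (c%:MP *: m), (c%:MP *: n), (c%:MP *: r).
      by split; [exact: qrelZ|exact: qrelZ|rewrite scalerBr].
  apply/qeqP; apply: findimS (findim_image g subD ff') => d.
  move=> [m [l [l' [[n fn gl] [n' fn' gl'] ->]]]].
  by exists (n - n'); [exists m, n, n'|apply: qrelB].
apply/qeqP; pose P0 n := (exists l, qrel g n l) /\ (exists l, qrel g' n l).
have subP0 : ksub P0.
  have [d0 dD dZ] := ksub_dom g; have [e0 eD eZ] := ksub_dom g'.
  split=> [//|a b [ga ga'] [gb gb']|c a [ga ga']].
    by split; [apply: dD|apply: eD].
  by split; [apply: dZ|apply: eZ].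
have cofP := cofindim_pre (ksub_graph f') subP0 (qdom_int g g') (qrel_dom f').
have [f0 fD fZ] := ksub_graph f'; have [P00 P0D P0Z] := subP0.
apply: (qdiff_cofin _ cofP).
  split=> [|a b [n Pn fn] [n' Pn' fn']|c a [n Pn fn]]; first by exists 0.
    by exists (n + n'); [apply: P0D|apply: qrelD].
  by exists (c%:MP *: n); [apply: P0Z|apply: qrelZ].
have fin1 := findim_image g (ksub_ind f') (qrel_ind f').
have fin2 := findim_image g' (ksub_ind f') (qrel_ind f').
apply: findimS (findimD (findimD fin1 gg') fin2) => d.
move=> [m [l [l' [[n0 [[l0 gl0] [l0' gl0']] fn0] [n fn gl] [n' fn' gl'] ->]]]].
exists ((l - l0) + (l0 - l0')), (l0' - l'); split.
- exists (l - l0), (l0 - l0'); split=> //; last by exists n0, l0, l0'.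
  by exists (n - n0); [rewrite -(subrr m)|]; apply: qrelB.
- by exists (n0 - n'); [rewrite -(subrr m)|]; apply: qrelB.
- by rewrite !addrA !subrK.
Qed.

Lemma qadd_eq (M N : gmodule) (f f' g g' : qhom M N) :
  qeq f f' -> qeq g g' -> qeq (qadd f g) (qadd f' g').
Proof.
move=> /qeqP ff' /qeqP gg'; apply/qeqP; apply: findimS (findimD ff' gg') => d.
move=> [m [_ [_ [[a [b [fa gb ->]]] [a' [b' [fa' gb' ->]]] ->]]]].
exists (a - a'), (b - b'); split; last by rewrite opprD addrACA.
  by exists m, a, a'.
by exists m, b, b'.
Qed.

Lemma qscale_eq (M N : gmodule) c (f g : qhom M N) :
  qeq f g -> qeq (qscale c f) (qscale c g).
Proof.
move=> /qeqP[s hs]; apply/qeqP; exists s => d.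
move=> [m [_ [_ [[a fa ->] [b gb ->] ->]]]]; rewrite -scalerBr; apply: kspanZ.
by apply: hs; exists m, a, b.
Qed.

(* coh-X(p,q): finitely generated graded modules, with morphisms taken in    *)
(* the quotient category                                                     *)
Record sheaf := Sheaf { smod :> gmodule; sheaf_fg : fin_gen smod }.

Program Definition coh : lincat k :=
  @LinCat k sheaf (fun A B => qhom A B) (fun A B => @qeq A B)
    (fun A => qid A) (fun A B C => @qcomp A B C) (fun A B => qzero A B)
    (fun A B => @qadd A B) (fun A B => @qscale A B)
    _ _ _ _ _ _ _ _ _ _ _ _ _ _ _ _ _ _ _ _ _.
Next Obligation. by move=> A B f; apply: qeq_refl. Qed.
Next Obligation. by move=> A B f g; apply: qeq_sym. Qed.
Next Obligation. by move=> A B f g h; apply: qeq_trans. Qed.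
Next Obligation. by move=> A B C g g' f f'; apply: qcomp_eq. Qed.
Next Obligation.
move=> A B C D h g f; apply: qeq_incl => m n [b [a fa gb] hn].
by exists a => //; exists b.
Qed.
Next Obligation. by move=> A B f; apply: qeq_incl => m n [a fa <-]. Qed.
Next Obligation. by move=> A B f; apply: qeq_incl => m n [a <- fa]. Qed.
Next Obligation. by move=> A B f f' g g'; apply: qadd_eq. Qed.
Next Obligation.
move=> A B f g h; apply: qeq_incl => m n [a [b [fa [c [d [gc hd ->]]] ->]]].
by exists (a + c), d; rewrite addrA; split=> //; exists a, c.
Qed.
Next Obligation.
move=> A B f g; apply: qeq_incl => m n [a [b [fa gb ->]]].
by exists b, a; rewrite addrC.
Qed.
Next Obligation.
by move=> A B f; apply: qeq_incl => m n [a [b [/= -> fb ->]]]; rewrite add0r.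
Qed.
Next Obligation.
move=> A B f; apply/qeqP; apply: findimS (qrel_ind f) => d.
move=> [m [_ [_ [[_ [b [[a fa ->] fb ->]]] -> ->]]]].
by rewrite mpolyCN mpolyC1 scaleN1r subr0 addrC -(subrr m); apply: qrelB.
Qed.
Next Obligation. by move=> A B c f g; apply: qscale_eq. Qed.
Next Obligation.
move=> A B c d f; apply: qeq_incl => m _ [_ [a fa ->] ->].
by exists a => //; rewrite mpolyCM scalerA.
Qed.
Next Obligation.
by move=> A B f; apply: qeq_incl => m _ [a fa ->]; rewrite mpolyC1 scale1r.
Qed.
Next Obligation.
move=> A B c f g; apply: qeq_incl => m _ [_ [a [b [fa gb ->]]] ->].
by exists (c%:MP *: a), (c%:MP *: b); rewrite scalerDr; split; [exists a|exists b|].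
Qed.
Next Obligation.
move=> A B c d f; apply: qeq_incl => m _ [a fa ->].
exists (c%:MP *: a), (d%:MP *: a).
by rewrite mpolyCD scalerDl; split=> //; exists a.
Qed.
Next Obligation.
move=> A B C h f g; apply/qeq_sym/qeq_incl => m l [l1 [l2 [[a fa ha] [b gb hb] ->]]].
by exists (a + b); [exists a, b|apply: qrelD].
Qed.
Next Obligation.
move=> A B C g h f; apply: qeq_incl => m _ [a fa [b [c [gb hc ->]]]].
by exists b, c; split=> //; exists a.
Qed.
Next Obligation.
move=> A B C c g f; apply/qeq_sym/qeq_incl => m l [l1 [a fa ga] ->].
by exists (c%:MP *: a); [exists a|apply: qrelZ].
Qed.
Next Obligation.
move=> A B C c g f; apply: qeq_incl => m _ [a fa [b gb ->]].
by exists b => //; exists a.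
Qed.

Definition Spart (x : L) (f : S^o) : S^o :=
  \sum_(m <- msupp f | degL m == x) f@_m *: 'X_[m].

Lemma mcoeff_Spart x (f : S) m :
  (Spart x f : S)@_m = if degL m == x then f@_m else 0.
Proof.
rewrite /Spart raddf_sum big_mkcond /=.
have [msf|msf] := boolP (m \in msupp f); last first.
  rewrite (memN_msupp_eq0 msf) if_same big_seq big1 // => m' m'f.
  case: ifP => // _; rewrite mcoeffZ mcoeffX.
  by case: eqP => [mm'|_]; [rewrite -mm' m'f in msf|rewrite mulr0].
rewrite (bigD1_seq m) ?msupp_uniq //= big1 ?addr0 => [|m' m'm].
  by case: ifP => // _; rewrite mcoeffZ mcoeffX eqxx mulr1.
by case: ifP => // _; rewrite mcoeffZ mcoeffX (negbTE m'm) mulr0.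
Qed.

Lemma degLD m m' : degL (m + m')%MM = degL m + degL m'.
Proof. by rewrite /degL !mnmDE !mulrnDr addrACA. Qed.

Lemma Spart_homog x (f : S) : (Spart x f = f) <-> homogS x f.
Proof.
split=> [<-|/allP fx].
  apply/allP => m; rewrite mcoeff_msupp mcoeff_Spart.
  by case: ifP => //; rewrite eqxx.
apply/mpolyP => m; rewrite mcoeff_Spart; case: ifP => // mx.
by rewrite memN_msupp_eq0 //; apply: contraFN mx => /fx.
Qed.

Program Definition Sgr : gmodule := @GModule S^o Spart _ _ _ _.
Next Obligation.
move=> x f g; apply/mpolyP => m; rewrite mcoeffB !mcoeff_Spart mcoeffB.
by case: ifP => // _; rewrite subr0.
Qed.
Next Obligation.
move=> x y f; apply/mpolyP => m; rewrite mcoeff_Spart.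
have [<-|xy] := eqVneq x y; rewrite ?mcoeff0 !mcoeff_Spart.
  by case: eqP.
by case: eqP => // ->; rewrite (negbTE xy).
Qed.
Next Obligation.
move=> f; exists (undup [seq degL m | m <- msupp f]); first exact: undup_uniq.
apply/mpolyP => m; rewrite raddf_sum /=.
have [msf|msf] := boolP (m \in msupp f); last first.
  rewrite (memN_msupp_eq0 msf) big1 // => x _.
  by rewrite mcoeff_Spart memN_msupp_eq0 ?if_same.
rewrite (bigD1_seq (degL m)) ?undup_uniq ?mem_undup ?map_f //=.
rewrite mcoeff_Spart eqxx big1 ?addr0 // => x xm.
by rewrite mcoeff_Spart eq_sym (negbTE xm).
Qed.
Next Obligation.
move=> x y f g fx /Spart_homog gy; apply/Spart_homog/allP => m.
move=> /msuppM_le/allpairsP[[m1 m2] /= [m1f m2g ->]].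
by rewrite degLD (eqP (allP fx _ m1f)) (eqP (allP gy _ m2g)).
Qed.

Lemma Sgr_fg : fin_gen Sgr.
Proof.
exists 1, (fun=> 1) => f; exists (fun=> f).
by rewrite big_ord1 /GRing.scale /= mulr1.
Qed.

Definition structure_sheaf : coh := Sheaf Sgr_fg.

Section QFun.
Variables (M N : gmodule) (phi : M -> N).
Hypothesis phiD : forall m n, phi (m + n) = phi m + phi n.
Hypothesis phiZ : forall (f : S) m, phi (f *: m) = f *: phi m.
Hypothesis phi_part : forall x m, phi (gpart M x m) = gpart N x (phi m).

Fact qfun0 : phi 0 = 0.
Proof. by rewrite -[0 in LHS](scale0r 0) phiZ scale0r. Qed.

Program Definition qfun : qhom M N :=
  @QHom M N (fun m n => n = phi m) _ _ _ _ _ _.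
Next Obligation. by rewrite /= qfun0. Qed.
Next Obligation. by move=> m m' n n' -> ->. Qed.
Next Obligation. by move=> f m n ->. Qed.
Next Obligation. by move=> x m n ->. Qed.
Next Obligation.
by exists [::] => m; exists m; [exists (phi m)|rewrite /= subrr].
Qed.
Next Obligation. by exists [::] => m /= ->; rewrite qfun0. Qed.

End QFun.

(* M(x)_y = M_(x + y) *)
Program Definition gshift (x : L) (M : gmodule) : gmodule :=
  @GModule M (fun y => gpart M (x + y)) _ _ _ _.
Next Obligation. by move=> x M y m n; apply: gpartB. Qed.
Next Obligation.
move=> x M y z m; rewrite /= gpartK.
by rewrite (inj_eq (addrI x)).
Qed.
Next Obligation.
move=> x M m; have [s us ms] := gpart_sum m.
exists [seq y - x | y <- s]; first by rewrite map_inj_uniq //; apply: addIr.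
by rewrite big_map {1}ms; apply: eq_bigr => y _; rewrite addrC subrK.
Qed.
Next Obligation.
move=> x M y z f m fy mz; rewrite /= addrCA; exact: gpart_scale.
Qed.

Definition shift_ob (x : L) (M : coh) : coh :=
  @Sheaf (gshift x (smod M)) (sheaf_fg M).

Program Definition shift_hom (x : L) (M N : coh) (f : hom coh M N) :
    hom coh (shift_ob x M) (shift_ob x N) :=
  @QHom (gshift x (smod M)) (gshift x (smod N)) (@qrel M N f) _ _ _ _ _ _.
Next Obligation. by move=> x M N f; apply: qrel0. Qed.
Next Obligation. by move=> x M N f m m' n n'; apply: qrelD. Qed.
Next Obligation. by move=> x M N f s m n; apply: qrelZ. Qed.
Next Obligation. by move=> x M N f y m n; apply: qrel_part. Qed.
Next Obligation. by move=> x M N f; exact (qrel_dom f). Qed.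
Next Obligation. by move=> x M N f; exact (qrel_ind f). Qed.

Program Definition shift_functor (x : L) : functor coh coh :=
  @Functor k coh coh (shift_ob x) (@shift_hom x) _ _ _ _ _.
Next Obligation.
by move=> x M N f g /= /qeqP fg; apply/qeqP.
Qed.
Next Obligation. by move=> x M; apply: qeq_incl. Qed.
Next Obligation. by move=> x M N P g f; apply: qeq_incl. Qed.
Next Obligation. by move=> x M N f g; apply: qeq_incl. Qed.
Next Obligation. by move=> x M N c f; apply: qeq_incl. Qed.

Lemma shiftK (x y : L) : x + y = 0 ->
  natiso (fcomp (shift_functor x) (shift_functor y)) (fid coh).
Proof.
move=> xy0.
have part (M : coh) z (m : smod M) :
    gpart (gshift x (gshift y (smod M))) z m = gpart (smod M) z m.
  by rewrite /= addrA [y + x]addrC xy0 add0r.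
pose a (M : coh) : hom coh (shift_ob x (shift_ob y M)) M :=
  @qfun (gshift x (gshift y (smod M))) (smod M) (fun m => m)
    (fun _ _ => erefl) (fun _ _ => erefl) (part M).
pose b (M : coh) : hom coh M (shift_ob x (shift_ob y M)) :=
  @qfun (smod M) (gshift x (gshift y (smod M))) (fun m => m)
    (fun _ _ => erefl) (fun _ _ => erefl) (fun z m => esym (part M z m)).
exists a, b; split=> [M|M N f].
  by split; apply: qeq_incl => m n [l /= -> ->].
by apply: qeq_incl => m n [l /= fl ->]; exists m.
Qed.

Definition shift (x : L) : selfequiv coh :=
  @SelfEquiv k coh (shift_functor x) (ex_intro _ (shift_functor (- x))
    (conj (shiftK (addNr x)) (shiftK (subrr x)))).

Definition line_bundle (x : L) : coh := shift x structure_sheaf.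

(* For p = q: the self-equivalence sigma_{1,2}, which is the restriction of  *)
(* scalars along the automorphism of S exchanging x1 and x2                  *)

Definition swapS (f : S) : S := msym (tperm ord0 ord_max) f.

Definition swapL (x : L) : L := piL p q ((repr x).2, (repr x).1).

Lemma swapSK : involutive swapS.
Proof. by move=> f; rewrite /swapS -msymMm tperm2 msym1m. Qed.

Lemma swapS_const (c : k) : swapS c%:MP = c%:MP.
Proof. by rewrite -[c%:MP]alg_mpolyC /swapS msymZ msym1. Qed.

Definition twist (M : lmodType S) : Type := M.

Section Twist.
Variable M : lmodType S.

HB.instance Definition _ := GRing.Zmodule.on (twist M).

Definition twist_scale (f : S) (m : twist M) : twist M := swapS f *: (m : M).

Fact twist_scaleA f g m :
  twist_scale f (twist_scale g m) = twist_scale (f * g) m.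
Proof. by rewrite /twist_scale scalerA /swapS rmorphM. Qed.

Fact twist_scale1 : left_id 1 twist_scale.
Proof. by move=> m; rewrite /twist_scale /swapS rmorph1 scale1r. Qed.

Fact twist_scaleDr : right_distributive twist_scale +%R.
Proof. by move=> f m n; rewrite /twist_scale scalerDr. Qed.

Fact twist_scaleDl m : {morph twist_scale^~ m : f g / f + g}.
Proof. by move=> f g; rewrite /twist_scale /swapS rmorphD scalerDl. Qed.

HB.instance Definition _ := GRing.Zmodule_isLmodule.Build S (twist M)
  twist_scaleA twist_scale1 twist_scaleDr twist_scaleDl.

Lemma twist_scaleE (f : S) (m : M) : f *: (m : twist M) = swapS f *: m.
Proof. by []. Qed.

Lemma twist_kspan (s : seq M) (m : M) :
  kspan (s : seq (twist M)) m <-> kspan s m.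
Proof.
elim: s m => [|e s IH] m //=; split=> -[c hc]; exists c.
  by move: hc; rewrite twist_scaleE swapS_const => /IH.
by apply/IH; rewrite twist_scaleE swapS_const.
Qed.

Lemma twist_findim (P : M -> Prop) :
  findim (P : twist M -> Prop) <-> findim P.
Proof. by split=> -[s hs]; exists s => m /hs /twist_kspan. Qed.

Lemma twist_cofindim (P : M -> Prop) :
  cofindim P -> cofindim (P : twist M -> Prop).
Proof.
by move=> [s hs]; exists s => m; have [n Pn /twist_kspan] := hs m; exists n.
Qed.

End Twist.

Section Sigma.
Hypothesis pq : p = q.

Lemma piLP (x : L) : exists v, x = piL p q v.
Proof. by exists (repr x); rewrite /piL reprK. Qed.

Lemma piLD (u v : int * int) : piL p q (u + v) = piL p q u + piL p q v.
Proof. exact: raddfD. Qed.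

Lemma swapL_pi (v : int * int) : swapL (piL p q v) = piL p q (v.2, v.1).
Proof.
rewrite /swapL /piL; apply/eqP; rewrite -Quotient.idealrBE.
case: piP => w /eqP; rewrite -Quotient.idealrBE => /asboolP[n vw].
apply/asboolP; exists n.
have /= [v1 v2] : v.1 - w.1 = p%:Z * n /\ v.2 - w.2 = - (q%:Z * n).
  by case: (v) (w) vw => [? ?] [? ?] [-> ->].
by congr (_, _); rewrite /= -opprB ?v1 ?v2 ?opprK ?pq.
Qed.

Lemma swapLD x y : swapL (x + y) = swapL x + swapL y.
Proof.
have [[u ->] [v ->]] := (piLP x, piLP y).
by rewrite -piLD !swapL_pi -piLD.
Qed.

Lemma swapLK : involutive swapL.
Proof.
by move=> x; have [[a b] ->] := piLP x; rewrite (swapL_pi (a, b)) swapL_pi.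
Qed.

Lemma swapL_x1 : swapL (x1 p q) = x2 p q.
Proof. exact: swapL_pi. Qed.

Lemma swapL_x2 : swapL (x2 p q) = x1 p q.
Proof. exact: swapL_pi. Qed.

Lemma homogS_swap x f : homogS x f -> homogS (swapL x) (swapS f).
Proof.
move=> /allP fx; apply/allP => m; rewrite mcoeff_msupp mcoeff_sym.
rewrite -mcoeff_msupp => /fx /eqP <-; rewrite /degL !swapLD.
have swapMn y n : swapL (y *+ n) = swapL y *+ n.
  elim: n => [|n IH]; last by rewrite !mulrS swapLD IH.
  by apply: (addrI (swapL 0)); rewrite mulr0n -swapLD !addr0.
by rewrite !swapMn swapL_x1 swapL_x2 !mnmE tpermL tpermR addrC.
Qed.

Program Definition gswap (M : gmodule) : gmodule :=
  @GModule (twist M) (fun y => gpart M (swapL y)) _ _ _ _.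
Next Obligation. by move=> M x m n; apply: gpartB. Qed.
Next Obligation.
by move=> M x y m; rewrite /= gpartK (inj_eq (inv_inj swapLK)).
Qed.
Next Obligation.
move=> M m; have [s us ms] := gpart_sum m.
exists (map swapL s); first by rewrite map_inj_uniq //; apply: inv_inj swapLK.
by rewrite big_map {1}ms; apply: eq_bigr => y _; rewrite swapLK.
Qed.
Next Obligation.
move=> M x y f m fx my; rewrite /= twist_scaleE swapLD.
by apply: gpart_scale => //; apply: homogS_swap.
Qed.

Lemma gswap_fg (M : coh) : fin_gen (gswap (smod M)).
Proof.
have [n [e he]] := sheaf_fg M; exists n, e => m; have [a ->] := he m.
exists (swapS \o a); apply: eq_bigr => i _.
by rewrite twist_scaleE /= swapSK.
Qed.

Definition sigma_ob (M : coh) : coh := Sheaf (gswap_fg M).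

Program Definition sigma_hom (M N : coh) (f : hom coh M N) :
    hom coh (sigma_ob M) (sigma_ob N) :=
  @QHom (gswap (smod M)) (gswap (smod N)) (@qrel M N f) _ _ _ _ _ _.
Next Obligation. by move=> M N f; apply: qrel0. Qed.
Next Obligation. by move=> M N f m m' n n'; apply: qrelD. Qed.
Next Obligation. by move=> M N f s m n; apply: qrelZ. Qed.
Next Obligation. by move=> M N f y m n; apply: qrel_part. Qed.
Next Obligation. move=> M N f; exact (twist_cofindim (qrel_dom f)). Qed.
Next Obligation.
move=> M N f; apply: (iffRL (twist_findim _)); exact (qrel_ind f).
Qed.

Program Definition sigma_functor : functor coh coh :=
  @Functor k coh coh sigma_ob sigma_hom _ _ _ _ _.
Next Obligation.
by move=> M N f g /= /qeqP fg; apply/qeqP/twist_findim.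
Qed.
Next Obligation. by move=> M; apply: qeq_incl. Qed.
Next Obligation. by move=> M N P g f; apply: qeq_incl. Qed.
Next Obligation. by move=> M N f g; apply: qeq_incl. Qed.
Next Obligation.
move=> M N c f; apply: qeq_incl => m n [l fl ->]; exists l => //.
by rewrite twist_scaleE swapS_const.
Qed.

Lemma sigmaK : natiso (fcomp sigma_functor sigma_functor) (fid coh).
Proof.
have part (M : coh) z (m : smod M) :
    gpart (gswap (gswap (smod M))) z m = gpart (smod M) z m.
  by rewrite /= swapLK.
have scal (M : coh) (f : S) (m : smod M) :
    (f *: (m : gswap (gswap (smod M))) : smod M) = f *: m.
  by rewrite twist_scaleE twist_scaleE swapSK.
pose a (M : coh) : hom coh (sigma_ob (sigma_ob M)) M :=
  @qfun (gswap (gswap (smod M))) (smod M) (fun m => m)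
    (fun _ _ => erefl) (scal M) (part M).
pose b (M : coh) : hom coh M (sigma_ob (sigma_ob M)) :=
  @qfun (smod M) (gswap (gswap (smod M))) (fun m => m)
    (fun _ _ => erefl) (fun f m => esym (scal M f m))
    (fun z m => esym (part M z m)).
exists a, b; split=> [M|M N f].
  by split; apply: qeq_incl => m n [l /= -> ->].
by apply: qeq_incl => m n [l /= fl ->]; exists m.
Qed.

Definition sigma12 : selfequiv coh :=
  @SelfEquiv k coh sigma_functor
    (ex_intro _ sigma_functor (conj sigmaK sigmaK)).

End Sigma.

(* the line bundles are exactly the indecomposable vector bundles *)
Definition vector_bundle (E : coh) : Prop :=
  exists (n : nat) (x : 'I_n -> L), direct_sum E (fun i => line_bundle (x i)).

Definition tilting_bundle (T : coh) : Prop := tilting T /\ vector_bundle T.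

End Graded.

Arguments gpart {k p q} M x m : rename.

(* All the marked points of the strip R x [0,1] have rational coordinates. *)
Definition point := (rat * rat)%type.

(* a segment, given by its lower and its upper endpoints *)
Definition arc := (point * point)%type.

Section Arcs.
Variables (k : fieldType) (p q : nat).

Definition lower (j : int) : point := (j%:~R / q%:R, 0).
Definition upper (i : int) : point := (i%:~R / p%:R, 1).

Definition Gamma (T : coh k p q) (D : arc) : Prop :=
  exists i j : int, D = (lower j, upper i) /\
    summand (line_bundle k (x1 p q *~ i - x2 p q *~ j)) T.

Definition rotate (z : point) : point := (- z.1, 1 - z.2).

Definition rotate_arcs (G : arc -> Prop) (D : arc) : Prop :=
  exists D', G D' /\ D = (rotate D'.2, rotate D'.1).

(* For 1 <= i <= p, the third vertex of the triangle of G containing the     *)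
(* segment from ((i-1)/p, 1) to (i/p, 1) is (c_i/q, 0): the two other sides  *)
(* of this triangle are arcs of G. The entries of c are numbered from 0.     *)
Definition third_vertices (G : arc -> Prop) (c : seq int) : Prop :=
  forall i : nat, (i < p)%N ->
    G (lower c`_i, upper i) /\ G (lower c`_i, upper i.+1).

End Arcs.

(* The vertices (c_1, ..., c_p) of the graph: c_1 <= ... <= c_p <= c_1 + q   *)
Definition Lambda (p q : nat) : Type :=
  {c : p.-tuple int | sorted <=%R (rcons c (head 0 c + q%:Z))}.

Definition coords p q (nu : Lambda p q) : seq int := tval (val nu).

(* the graph of the map phi: phi(T) = nu *)
Definition phi k p q (T : coh k p q) (nu : Lambda p q) : Prop :=
  third_vertices p q (Gamma T) (coords nu).

(* phi (eta nu) = nu and eta (phi T) = T, tilting bundles being taken up to  *)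
(* isomorphism                                                               *)
Definition inverse_phi k p q (eta : Lambda p q -> coh k p q) : Prop :=
  (forall nu, tilting_bundle (eta nu) /\ phi (eta nu) nu) /\
  (forall T nu, tilting_bundle T -> phi T nu -> iso T (eta nu)).

(* The group H~, presented by generators and relations. For p <> q, sigma is *)
(* trivial and this is H = < r1, r2 | r1 r2 = r2 r1, r1^p = r2^q >. For      *)
(* p = q it is the split extension of Z_2 = < sigma > by H where sigma       *)
(* exchanges r1 and r2. If sigma commuted with r1 and r2, then for p = q >= 2*)
(* the assignments r1 |-> (x1), r2 |-> (x2), sigma |-> sigma_{1,2} would not *)
(* extend to a homomorphism, and sigma |-> rho would not extend to an action,*)
(* because sigma_{1,2} o (x1) = (x2) o sigma_{1,2} and rho o r1 = r2 o rho.  *)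
Variant hgen := R1 | R2 | Sigma.
HB.instance Definition _ := gen_eqMixin hgen.
HB.instance Definition _ := gen_choiceMixin hgen.

(* (g, true) stands for g, and (g, false) for its inverse *)
Definition hword := seq (hgen * bool).

Definition wgen (g : hgen) : hword := [:: (g, true)].

Inductive hrel (p q : nat) : hword -> hword -> Prop :=
| hrel_comm : hrel p q (wgen R1 ++ wgen R2) (wgen R2 ++ wgen R1)
| hrel_pow : hrel p q (nseq p (R1, true)) (nseq q (R2, true))
| hrel_sigma2 : p = q -> hrel p q (wgen Sigma ++ wgen Sigma) [::]
| hrel_sigma : p = q ->
    hrel p q (wgen Sigma ++ wgen R1) (wgen R2 ++ wgen Sigma)
| hrel_triv : p <> q -> hrel p q (wgen Sigma) [::].

Inductive hcong (p q : nat) : hword -> hword -> Prop :=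
| hcong_rel u v : hrel p q u v -> hcong p q u v
| hcong_inv g b : hcong p q [:: (g, b); (g, ~~ b)] [::]
| hcong_cat u u' v v' :
    hcong p q u u' -> hcong p q v v' -> hcong p q (u ++ v) (u' ++ v')
| hcong_refl u : hcong p q u u
| hcong_sym u v : hcong p q u v -> hcong p q v u
| hcong_trans u v w : hcong p q u v -> hcong p q v w -> hcong p q u w.

Section Htilde.
Variables p q : nat.

Definition hequiv : rel hword := fun u v => `[< hcong p q u v >].

Fact hequiv_refl : reflexive hequiv.
Proof. by move=> u; apply/asboolP/hcong_refl. Qed.

Fact hequiv_sym : ssrbool.symmetric hequiv.
Proof. by move=> u v; apply/asboolP/asboolP; apply: hcong_sym. Qed.

Fact hequiv_trans : transitive hequiv.
Proof.
by move=> v u w /asboolP uv /asboolP vw; apply/asboolP/(hcong_trans uv).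
Qed.

Canonical hequiv_equiv := EquivRel hequiv hequiv_refl hequiv_sym hequiv_trans.

Definition Htilde := {eq_quot hequiv}.
HB.instance Definition _ := Choice.on Htilde.

Definition hpi (u : hword) : Htilde := \pi_Htilde u.

Lemma hpiP (x : Htilde) : exists u, x = hpi u.
Proof. by exists (repr x); rewrite /hpi reprK. Qed.

Lemma hpiE u v : hcong p q u v <-> hpi u = hpi v.
Proof.
split=> [uv|/eqP]; first by apply/eqP; rewrite eqmodE; apply/asboolP.
by rewrite eqmodE => /asboolP.
Qed.

Lemma hpi_repr u : hcong p q (repr (hpi u)) u.
Proof. by apply/hpiE; rewrite /hpi reprK. Qed.

Definition winv (u : hword) : hword := rev [seq (x.1, ~~ x.2) | x <- u].

Lemma winvK : involutive winv.
Proof.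
move=> u; rewrite /winv map_rev revK -map_comp -[RHS]map_id.
by apply: eq_map => -[g b] /=; rewrite negbK.
Qed.

Lemma winv_catr u : hcong p q (u ++ winv u) [::].
Proof.
elim: u => [|[g b] u IH]; first exact: hcong_refl.
rewrite /winv /= rev_cons -cats1 -cat1s !catA -[X in X ++ _]catA.
apply: hcong_trans (hcong_inv p q g b).
apply: (@hcong_cat _ _ _ [:: (g, b)]); last exact: hcong_refl.
by rewrite -[X in hcong _ _ _ X]cats0; apply: hcong_cat IH; apply: hcong_refl.
Qed.

Lemma winv_catl u : hcong p q (winv u ++ u) [::].
Proof. by rewrite -{2}[u]winvK; apply: winv_catr. Qed.

Lemma winv_cong u v : hcong p q u v -> hcong p q (winv u) (winv v).
Proof.
move=> uv; rewrite -[winv u]cats0.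
apply: (@hcong_trans _ _ _ (winv u ++ (v ++ winv v))).
  by apply: hcong_cat (hcong_sym (winv_catr v)); apply: hcong_refl.
rewrite catA -[X in hcong _ _ _ X]cat0s; apply: hcong_cat (hcong_refl _ _ _).
apply: hcong_trans (winv_catl u); apply: hcong_cat (hcong_sym uv).
exact: hcong_refl.
Qed.

Definition hmul (x y : Htilde) : Htilde := hpi (repr x ++ repr y).
Definition hinv (x : Htilde) : Htilde := hpi (winv (repr x)).

Lemma hmulE u v : hmul (hpi u) (hpi v) = hpi (u ++ v).
Proof. by apply/hpiE/hcong_cat; apply: hpi_repr. Qed.

Lemma hinvE u : hinv (hpi u) = hpi (winv u).
Proof. exact/hpiE/winv_cong/hpi_repr. Qed.

Fact hmulA : associative hmul.
Proof.
move=> x y z; have [[u ->] [v ->] [w ->]] := And3 (hpiP x) (hpiP y) (hpiP z).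
by rewrite !hmulE catA.
Qed.

Fact hmul1 : left_id (hpi [::]) hmul.
Proof. by move=> x; have [u ->] := hpiP x; rewrite hmulE. Qed.

Fact hmul1r : right_id (hpi [::]) hmul.
Proof. by move=> x; have [u ->] := hpiP x; rewrite hmulE cats0. Qed.

Fact hmulV : left_inverse (hpi [::]) hinv hmul.
Proof.
move=> x; have [u ->] := hpiP x; rewrite hinvE hmulE.
exact/hpiE/winv_catl.
Qed.

Fact hmulVr : right_inverse (hpi [::]) hinv hmul.
Proof.
move=> x; have [u ->] := hpiP x; rewrite hinvE hmulE.
exact/hpiE/winv_catr.
Qed.

HB.instance Definition _ :=
  isGroup.Build Htilde hmulA hmul1 hmul1r hmulV hmulVr.

Definition r1 : Htilde := hpi (wgen R1).
Definition r2 : Htilde := hpi (wgen R2).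
Definition sigma : Htilde := hpi (wgen Sigma).

End Htilde.

(* the last clause says that sigma acts as the involution rho                *)
Definition Lambda_action k p q (act : Htilde p q -> Lambda p q -> Lambda p q) :
    Prop :=
  [/\ forall nu, act 1%g nu = nu,
      forall f g nu, act (f * g)%g nu = act f (act g nu),
      forall nu, coords (act (r1 p q) nu) =
        belast (last 0 (coords nu) - q%:Z) (coords nu),
      forall nu, coords (act (r2 p q) nu) = [seq c - 1 | c <- coords nu] &
      p = q -> forall (T : coh k p q) nu, tilting_bundle T -> phi T nu ->
        third_vertices p q (rotate_arcs (Gamma T))
          (coords (act (sigma p q) nu))].

(* a homomorphism to Aut(coh-X(p,q)), where equality is [natiso]. It is not  *)
(* required to be onto: the self-equivalences induced by x2 |-> a x2, a in k,*)
(* a <> 0, fix all the line bundles without being isomorphic to the identity.*)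
Definition Aut_morphism k p q (psi : Htilde p q -> selfequiv (coh k p q)) :
    Prop :=
  [/\ forall f g, natiso (psi (f * g)%g) (fcomp (psi f) (psi g)),
      natiso (psi (r1 p q)) (shift k (x1 p q)),
      natiso (psi (r2 p q)) (shift k (x2 p q)) &
      forall pq : p = q, natiso (psi (sigma p q)) (sigma12 k pq)].

Section NatIso.
Variable k : fieldType.
Implicit Types C D E : lincat k.

Lemma natiso_refl C D (F : functor C D) : natiso F F.
Proof.
exists (fun A => idm D (F A)), (fun A => idm D (F A)); split=> [A|A B f].
  by split; apply: hcomp1f.
by apply: heq_trans (hcomp1f _) _; apply/heq_sym/hcompf1.
Qed.

Lemma natiso_sym C D (F G : functor C D) : natiso F G -> natiso G F.
Proof.
move=> [a [b [ab nat_a]]]; exists b, a; split=> [A|A B f].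
  by have [] := ab A.
have [ba1 _] := ab B; have [_ ab1] := ab A.
apply: heq_trans (heq_sym (hcompf1 _)) _.
apply: heq_trans (hcomp_eq (heq_refl _) (heq_sym ab1)) _.
apply: heq_trans (hcompA _ _ _) _; apply: hcomp_eq (heq_refl _).
apply: heq_trans (heq_sym (hcompA _ _ _)) _.
apply: heq_trans (hcomp_eq (heq_refl _) (heq_sym (nat_a _ _ f))) _.
apply: heq_trans (hcompA _ _ _) _.
by apply: heq_trans (hcomp_eq ba1 (heq_refl _)) (hcomp1f _).
Qed.

Lemma natiso_trans C D (F G H : functor C D) :
  natiso F G -> natiso G H -> natiso F H.
Proof.
move=> [a [b [ab nat_a]]] [a' [b' [ab' nat_a']]].
have cancel A (X Y Z : D) (u : hom D X Y) (v : hom D Y X) (u' : hom D Y Z)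
    (v' : hom D Z Y) :
    v ∘ u ≈ idm D X -> v' ∘ u' ≈ A Y -> A Y ≈ idm D Y ->
    (v ∘ v') ∘ (u' ∘ u) ≈ idm D X.
  move=> vu vu' AY; apply: heq_trans (hcompA _ _ _) _.
  apply: heq_trans (hcomp_eq (heq_sym (hcompA _ _ _)) (heq_refl _)) _.
  apply: heq_trans (hcomp_eq (hcomp_eq (heq_refl _) vu') (heq_refl _)) _.
  apply: heq_trans (hcomp_eq (hcomp_eq (heq_refl _) AY) (heq_refl _)) _.
  by apply: heq_trans (hcomp_eq (hcompf1 _) (heq_refl _)) vu.
exists (fun A => a' A ∘ a A), (fun A => b A ∘ b' A); split=> [A|A B f].
  have [h1 h2] := ab A; have [h3 h4] := ab' A; split.
    exact: (cancel (idm D) _ _ _ _ _ _ _ h1 h3 (heq_refl _)).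
  exact: (cancel (idm D) _ _ _ _ _ _ _ h4 h2 (heq_refl _)).
apply: heq_trans (heq_sym (hcompA _ _ _)) _.
apply: heq_trans (hcomp_eq (heq_refl _) (nat_a _ _ f)) _.
apply: heq_trans (hcompA _ _ _) _.
apply: heq_trans (hcomp_eq (nat_a' _ _ f) (heq_refl _)) _.
exact/heq_sym/hcompA.
Qed.

Lemma natiso_fcomp C D E (G G' : functor D E) (F F' : functor C D) :
  natiso G G' -> natiso F F' -> natiso (fcomp G F) (fcomp G' F').
Proof.
move=> [a [b [ab nat_a]]] [a' [b' [ab' nat_a']]].
apply: (@natiso_trans _ _ _ (fcomp G F')).
  exists (fun A => fmap G (a' A)), (fun A => fmap G (b' A)).
  split=> [A|A B f] /=.
    have [h1 h2] := ab' A; split; apply: heq_trans (heq_sym (fmap_comp _ _ _)) _;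
      by apply: heq_trans (fmap_eq G _) (fmap1 G _).
  apply: heq_trans (heq_sym (fmap_comp _ _ _)) _.
  by apply: heq_trans (fmap_eq G (nat_a' _ _ f)) (fmap_comp _ _ _).
exists (fun A => a (F' A)), (fun A => b (F' A)); split=> [A|A B f] /=.
  exact: ab.
exact: nat_a.
Qed.

Lemma natiso_fcompA C (H G F : functor C C) :
  natiso (fcomp H (fcomp G F)) (fcomp (fcomp H G) F).
Proof. by have := natiso_refl (fcomp H (fcomp G F)). Qed.

Lemma natiso_comp1f C (F : functor C C) : natiso (fcomp (fid C) F) F.
Proof. by have := natiso_refl F. Qed.

Lemma natiso_compf1 C (F : functor C C) : natiso (fcomp F (fid C)) F.
Proof. by have := natiso_refl F. Qed.

End NatIso.

Lemma shiftD (k : fieldType) p q (x y z : L p q) : x + y = z ->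
  natiso (fcomp (shift_functor k x) (shift_functor k y)) (shift_functor k z).
Proof.
move=> <-.
have part (M : coh k p q) u (m : smod M) :
    gpart (gshift x (gshift y (smod M))) u m = gpart (gshift (x + y) (smod M)) u m.
  by rewrite /= addrA [y + x]addrC.
pose a (M : coh k p q) : hom _ (shift_ob x (shift_ob y M)) (shift_ob (x + y) M) :=
  @qfun _ _ _ (gshift x (gshift y (smod M))) (gshift (x + y) (smod M)) (fun m => m)
    (fun _ _ => erefl) (fun _ _ => erefl) (part M).
pose b (M : coh k p q) : hom _ (shift_ob (x + y) M) (shift_ob x (shift_ob y M)) :=
  @qfun _ _ _ (gshift (x + y) (smod M)) (gshift x (gshift y (smod M))) (fun m => m)
    (fun _ _ => erefl) (fun _ _ => erefl) (fun u m => esym (part M u m)).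
exists a, b; split=> [M|M N f].
  by split; apply: qeq_incl => m n [l /= -> ->].
by apply: qeq_incl => m n [l /= fl ->]; exists m.
Qed.

Lemma shift0 (k : fieldType) p q : natiso (shift_functor k (0 : L p q)) (fid _).
Proof.
apply: natiso_trans (natiso_sym (shiftD k (addr0 (0 : L p q)))) _.
exact/shiftK/addr0.
Qed.

Lemma sigma_shift (k : fieldType) p q (pq : p = q) (x : L p q) :
  natiso (fcomp (sigma_functor k pq) (shift_functor k x))
    (fcomp (shift_functor k (swapL x)) (sigma_functor k pq)).
Proof.
have part (M : coh k p q) u (m : smod M) :
    gpart (gswap pq (gshift x (smod M))) u m =
    gpart (gshift (swapL x) (gswap pq (smod M))) u m.
  by rewrite /= swapLD // swapLK.
pose a (M : coh k p q) :
    hom _ (sigma_ob pq (shift_ob x M)) (shift_ob (swapL x) (sigma_ob pq M)) :=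
  @qfun _ _ _ (gswap pq (gshift x (smod M)))
    (gshift (swapL x) (gswap pq (smod M))) (fun m => m)
    (fun _ _ => erefl) (fun _ _ => erefl) (part M).
pose b (M : coh k p q) :
    hom _ (shift_ob (swapL x) (sigma_ob pq M)) (sigma_ob pq (shift_ob x M)) :=
  @qfun _ _ _ (gshift (swapL x) (gswap pq (smod M)))
    (gswap pq (gshift x (smod M))) (fun m => m)
    (fun _ _ => erefl) (fun _ _ => erefl) (fun u m => esym (part M u m)).
exists a, b; split=> [M|M N f].
  by split; apply: qeq_incl => m n [l /= -> ->].
by apply: qeq_incl => m n [l /= fl ->]; exists m.
Qed.

Lemma x1x2 p q : x1 p q *+ p = x2 p q *+ q.
Proof.
have pin v n : piL p q v *+ n = piL p q (v *+ n).
  elim: n => [|n IH]; last by rewrite !mulrS piLD IH.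
  by apply: (addrI (piL p q 0)); rewrite -piLD !addr0.
rewrite !pin /piL; apply/eqP; rewrite -Quotient.idealrBE.
apply/asboolP; exists 1; rewrite !mulr1.
have pairMn (a b : int) n : (a, b) *+ n = (a *+ n, b *+ n).
  by elim: n => // n IH; rewrite !mulrS IH.
rewrite !pairMn !mul0rn; congr (_, _); rewrite /= ?subr0 ?sub0r.
  by rewrite -mulr_natr mul1r natz.
by rewrite -mulr_natr mul1r natz.
Qed.

Section Psi.
Variables (k : fieldType) (p q : nat).
Local Notation C := (coh k p q).

Definition hfun (x : hgen * bool) : functor C C :=
  match x.1 with
  | R1 => shift_functor k (if x.2 then x1 p q else - x1 p q)
  | R2 => shift_functor k (if x.2 then x2 p q else - x2 p q)
  | Sigma => if @eqP _ p q is ReflectT e then sigma_functor k e else fid C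
  end.

Definition wfun (u : hword) : functor C C :=
  foldr (fun x F => fcomp (hfun x) F) (fid C) u.

Lemma wfun_cat u v : natiso (wfun (u ++ v)) (fcomp (wfun u) (wfun v)).
Proof.
elim: u => [|x u IH] /=; first exact/natiso_sym/natiso_comp1f.
apply: natiso_trans (natiso_fcompA _ _ _).
exact: natiso_fcomp (natiso_refl _) IH.
Qed.

Lemma wfun_gen g : natiso (wfun (wgen g)) (hfun (g, true)).
Proof. exact: natiso_compf1. Qed.

Lemma wfun_gens x y : natiso (wfun [:: x; y]) (fcomp (hfun x) (hfun y)).
Proof. exact: natiso_fcomp (natiso_refl _) (natiso_compf1 _). Qed.

Lemma wfun_cong u v : hcong p q u v -> natiso (wfun u) (wfun v).
Proof.
elim=> {u v} [u v uv|g b|u u' v v' _ IHu _ IHv|u|u v _ IH|u v w _ IHu _ IHv].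
- have shiftn (x : hgen * bool) (y : L p q) n : hfun x = shift_functor k y ->
      natiso (wfun (nseq n x)) (shift_functor k (y *+ n)).
    move=> xy; elim: n => [|n IH]; first exact/natiso_sym/shift0.
    apply: natiso_trans _ (shiftD k (esym (mulrS y n))).
    by rewrite /= -xy; apply: natiso_fcomp (natiso_refl _) IH.
  case: uv => [||pq|pq|pq].
  + apply: natiso_trans (wfun_gens _ _) _.
    apply: natiso_trans _ (natiso_sym (wfun_gens (R2, true) (R1, true))).
    apply: natiso_trans (shiftD k erefl) _.
    by rewrite addrC; apply/natiso_sym/shiftD.
  + apply: natiso_trans (shiftn (R1, true) (x1 p q) p erefl) _.
    by rewrite x1x2; exact: natiso_sym (shiftn (R2, true) (x2 p q) q erefl).
  + apply: natiso_trans (wfun_gens _ _) _; rewrite /hfun /=.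
    by case: eqP => // e; apply: sigmaK.
  + apply: natiso_trans (wfun_gens _ _) _.
    apply: natiso_trans _ (natiso_sym (wfun_gens (R2, true) (Sigma, true))).
    rewrite /hfun /=; case: eqP => // e; rewrite -(swapL_x1 e); apply: sigma_shift.
  + apply: natiso_trans (wfun_gen _) _; rewrite /hfun /=.
    by case: eqP => // _; apply: natiso_refl.
- apply: natiso_trans (wfun_gens _ _) _; rewrite /hfun /=; case: g.
  + by apply: shiftK; case: b; rewrite ?subrr ?addNr.
  + by apply: shiftK; case: b; rewrite ?subrr ?addNr.
  + by case: eqP => e; [apply: sigmaK|apply: natiso_comp1f].
- apply: natiso_trans (wfun_cat _ _) _.
  apply: natiso_trans _ (natiso_sym (wfun_cat _ _)).
  exact: natiso_fcomp IHu IHv.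
- exact: natiso_refl.
- exact: natiso_sym.
- exact: natiso_trans IHu IHv.
Qed.

Lemma wfun_inv u : exists G : functor C C,
  natiso (fcomp G (wfun u)) (fid C) /\ natiso (fcomp (wfun u) G) (fid C).
Proof.
exists (wfun (winv u)); split.
  apply: natiso_trans (natiso_sym (wfun_cat _ _)) _.
  exact: wfun_cong (winv_catl p q u).
apply: natiso_trans (natiso_sym (wfun_cat _ _)) _.
exact: wfun_cong (winv_catr p q u).
Qed.

Lemma Aut_morphism_exists :
  exists psi : Htilde p q -> selfequiv C, Aut_morphism psi.
Proof.
exists (fun f => SelfEquiv (wfun_inv (repr f))); split=> [f g|||pq] /=.
- apply: natiso_trans _ (wfun_cat _ _); exact/wfun_cong/hpi_repr.
- exact: natiso_trans (wfun_cong (hpi_repr _ _ _)) (wfun_gen _).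
- exact: natiso_trans (wfun_cong (hpi_repr _ _ _)) (wfun_gen _).
- apply: natiso_trans (wfun_cong (hpi_repr _ _ _)) _.
  apply: natiso_trans (wfun_gen _) _; rewrite /hfun /=.
  by case: eqP => // e; rewrite (Prop_irrelevance e pq); apply: natiso_refl.
Qed.

End Psi.

(* Main.v *)
(* A self-equivalence carries tilting sheaves to tilting sheaves, because the
   notion is categorical. The generators of H~ moreover permute the line
   bundles, and their effect on the arcs attached to the line-bundle summands
   is exactly their effect on the coordinates (using p x1 = q x2 for the
   wrap-around coordinate of r1). So phi (psi g T) = g (phi T) for each
   generator g; since eta is inverse to phi up to isomorphism, this is the
   claim for generators, and the claim is stable under products and inverses. *)
Require Import Defs.
From HB Require Import structures.
From Corelib Require Import Setoid Morphisms.
From mathcomp Require Import all_boot all_order all_algebra all_fingroup.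
From mathcomp Require Import generic_quotient boolp mpoly zify.

(* [Defs] is imported last because mathcomp's [vector] also defines [hom]. *)
Import GRing.Theory Num.Theory Defs.

(** * Linear categories: isomorphisms, direct sums and extensions *)

Section LinearCategories.
Local Set Implicit Arguments.
Local Unset Strict Implicit.
Local Open Scope cat_scope.
Local Open Scope ring_scope.
Variable k : fieldType.
Implicit Types C D : lincat k.

#[local] Instance heq_equivalence C (A B : C) : Equivalence (@heq k C A B).
Proof.
split; [exact: heq_refl|exact: heq_sym|move=> f g h; exact: heq_trans].
Qed.

#[local] Instance hcomp_proper C (A B X : C) :
  Proper (heq ==> heq ==> heq) (@hcomp k C A B X).
Proof. by move=> f f' ff' g g' gg'; apply: hcomp_eq. Qed.

#[local] Instance hadd_proper C (A B : C) :
  Proper (heq ==> heq ==> heq) (@hadd k C A B).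
Proof. by move=> f f' ff' g g' gg'; apply: hadd_eq. Qed.

#[local] Instance fmap_proper C D (F : functor C D) (A B : C) :
  Proper (heq ==> heq) (@fmap k C D F A B).
Proof. by move=> f f' ff'; apply: fmap_eq. Qed.

#[local] Hint Resolve heq_refl : core.

(** Zero is written as [(-1) h + h] with [h] zero, so that additivity and homogeneity of composition
    apply. *)
Lemma hcomp0r C (A B X : C) (f : hom C B X) :
  f ∘ (hzero : hom C A B) ≈ hzero.
Proof.
by rewrite -(haddNf (hzero : hom C A B)) hcompDr hcompZr haddNf.
Qed.

Lemma hcomp0l C (A B X : C) (f : hom C A B) :
  (hzero : hom C B X) ∘ f ≈ hzero.
Proof.
by rewrite -(haddNf (hzero : hom C B X)) hcompDl hcompZl haddNf.
Qed.

Lemma fmap0 C D (F : functor C D) (A B : C) :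
  fmap F (hzero : hom C A B) ≈ hzero.
Proof.
by rewrite -(haddNf (hzero : hom C A B)) fmapD fmapZ haddNf.
Qed.

Lemma iso_refl C (A : C) : iso A A.
Proof. by exists (idm C A), (idm C A); rewrite hcomp1f. Qed.

Lemma iso_sym C (A B : C) : iso A B -> iso B A.
Proof. by move=> [f [g [gf fg]]]; exists g, f. Qed.

Lemma iso_trans C (A B X : C) : iso A B -> iso B X -> iso A X.
Proof.
move=> [f [g [gf fg]]] [f' [g' [gf' fg']]]; exists (f' ∘ f), (g ∘ g'); split.
  by rewrite hcompA -(hcompA g) gf' hcompf1.
by rewrite hcompA -(hcompA f') fg hcompf1.
Qed.

Lemma functor_iso C D (F : functor C D) (A B : C) : iso A B -> iso (F A) (F B).
Proof.
move=> [f [g [gf fg]]]; exists (fmap F f), (fmap F g).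
by rewrite -!fmap_comp gf fg !fmap1.
Qed.

Lemma natiso_iso C D (F G : functor C D) (A : C) : natiso F G -> iso (F A) (G A).
Proof. by move=> [a [b [ab _]]]; exists (a A), (b A). Qed.

Lemma is_zero_iso C (A B : C) : iso A B -> is_zero A -> is_zero B.
Proof.
move=> [f [g [_ fg]]] A0.
by rewrite /is_zero -fg -(hcompf1 f) A0 hcomp0r hcomp0l.
Qed.

Lemma functor_is_zero C D (F : functor C D) (A : C) : is_zero A -> is_zero (F A).
Proof. by move=> A0; rewrite /is_zero -fmap1 A0 fmap0. Qed.

Lemma direct_sum_iso C (I : finType) (X Y : C) (A B : I -> C) :
  iso X Y -> (forall i, iso (A i) (B i)) -> direct_sum X A -> direct_sum Y B.
Proof.
move=> [f [g [gf fg]]] AB [inj [prj [diag offdiag sum]]].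
(* [iso] only asserts existence, so mutually inverse [u i] and [v i] are selected by choice. *)
pose u i := sval (cid (AB i)).
pose v i := sval (cid (svalP (cid (AB i)))).
have uvP i := svalP (cid (svalP (cid (AB i)))).
have vu i : v i ∘ u i ≈ idm C (A i) by case: (uvP i).
have uv i : u i ∘ v i ≈ idm C (B i) by case: (uvP i).
have mid i j : (u j ∘ prj j ∘ g) ∘ (f ∘ inj i ∘ v i) ≈
    u j ∘ (prj j ∘ inj i) ∘ v i.
  by rewrite !hcompA -(hcompA _ g f) gf hcompf1.
exists (fun i => f ∘ inj i ∘ v i), (fun i => u i ∘ prj i ∘ g); split.
- by move=> i; rewrite mid diag hcompf1 uv.
- by move=> i j ij; rewrite mid offdiag // hcomp0r hcomp0l.
- have dist : f ∘ (\big[hadd/hzero]_(i : I) (inj i ∘ prj i)) ∘ g ≈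
      \big[hadd/hzero]_(i : I) ((f ∘ inj i ∘ v i) ∘ (u i ∘ prj i ∘ g)).
    elim/big_rec2: _ => [|i x y _ IH]; first by rewrite hcomp0r hcomp0l.
    rewrite hcompDr hcompDl IH !hcompA -(hcompA _ (v i) (u i)) vu.
    by rewrite hcompf1.
  by rewrite -dist sum hcompf1.
Qed.

Lemma functor_direct_sum C D (F : functor C D) (I : finType) (X : C)
    (A : I -> C) :
  direct_sum X A -> direct_sum (F X) (fun i => F (A i)).
Proof.
move=> [inj [prj [diag offdiag sum]]].
exists (fun i => fmap F (inj i)), (fun i => fmap F (prj i)); split.
- by move=> i; rewrite -fmap_comp diag fmap1.
- by move=> i j ij; rewrite -fmap_comp offdiag // fmap0.
- rewrite -(fmap1 F) -sum.
  elim/big_rec2: _ => [|i x y _ IH]; first by rewrite fmap0.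
  by rewrite IH fmapD fmap_comp.
Qed.

Lemma direct_sum2_iso C (X Y A A' B B' : C) :
  iso X Y -> iso A A' -> iso B B' -> direct_sum2 X A B -> direct_sum2 Y A' B'.
Proof. by move=> XY AA' BB'; apply: direct_sum_iso => // -[]. Qed.

Lemma functor_direct_sum2 C D (F : functor C D) (X A B : C) :
  direct_sum2 X A B -> direct_sum2 (F X) (F A) (F B).
Proof.
(* The two families over [bool] agree only after a case split, hence the detour through
   isomorphisms. *)
move=> /(functor_direct_sum F); apply: direct_sum_iso; first exact: iso_refl.
by case; apply: iso_refl.
Qed.

Lemma summand_iso C (A A' X X' : C) :
  iso A A' -> iso X X' -> summand A X -> summand A' X'.
Proof.
move=> AA' XX' [B XAB]; exists B.
exact: direct_sum2_iso XX' AA' (iso_refl B) XAB.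
Qed.

Lemma functor_summand C D (F : functor C D) (A X : C) :
  summand A X -> summand (F A) (F X).
Proof. by move=> [B XAB]; exists (F B); apply: functor_direct_sum2. Qed.

(** Composing with the isomorphisms at both ends turns an extension of [X'] by [A'] into one of [X]
    by [A]; a section [s] of the latter gives the section [s ∘ x'] of the former. *)
Lemma ext1_zero_iso C (X X' A A' : C) :
  iso X X' -> iso A A' -> ext1_zero X A -> ext1_zero X' A'.
Proof.
move=> [x [x' [x'x xx']]] [a [a' [a'a aa']]] ext B f g [[gf0 ker] [_ cok]].
have [|s gs] := ext B (f ∘ a) (x' ∘ g).
  split; split=> [|Y h].
  - by rewrite -hcompA (hcompA g) gf0 hcomp0l hcomp0r.
  - move=> x'gh0; have [|u [fu uniq]] := ker Y h.
      by rewrite -(hcomp1f (g ∘ h)) -xx' -hcompA (hcompA x') x'gh0 hcomp0r.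
    exists (a' ∘ u); split=> [|v fav].
      by rewrite -hcompA (hcompA a) aa' hcomp1f.
    by rewrite -(uniq (a ∘ v)) ?hcompA // a'a hcomp1f.
  - by rewrite -hcompA (hcompA g) gf0 hcomp0l hcomp0r.
  - move=> hfa0; have [|u [ug uniq]] := cok Y h.
      by rewrite -(hcompf1 (h ∘ f)) -aa' hcompA -(hcompA h) hfa0 hcomp0l.
    exists (u ∘ x); split=> [|v vx'g].
      by rewrite hcompA -(hcompA u) xx' hcompf1.
    by rewrite -(uniq (v ∘ x')) -?hcompA // x'x hcompf1.
have xgsx : x ∘ (x' ∘ g ∘ s) ∘ x' ≈ idm C X' by rewrite gs hcompf1.
by exists (s ∘ x'); rewrite -xgsx !hcompA xx' hcomp1f.
Qed.

(** * Equivalences of linear categories *)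

Definition inverse_functors C D (F : functor C D) (G : functor D C) : Prop :=
  natiso (fcomp G F) (fid C) /\ natiso (fcomp F G) (fid D).

Lemma inverse_functors_sym C D (F : functor C D) (G : functor D C) :
  inverse_functors F G -> inverse_functors G F.
Proof. by case. Qed.

Section Equivalence.
Variables (C D : lincat k) (F : functor C D) (G : functor D C).
Hypothesis FG : inverse_functors F G.

Lemma equiv_unit (A : C) : iso (G (F A)) A.
Proof. exact: natiso_iso A FG.1. Qed.

Lemma equiv_counit (X : D) : iso (F (G X)) X.
Proof. exact: natiso_iso X FG.2. Qed.

(** Naturality of the unit recovers [f] as [a B ∘ fmap (fcomp G F) f ∘ b A]. *)
Lemma equiv_faithful (A B : C) (f g : hom C A B) : fmap F f ≈ fmap F g -> f ≈ g.
Proof.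
move=> fg; have [[a [b [ab nat]]] _] := FG.
have {}fg : fmap (fcomp G F) f ≈ fmap (fcomp G F) g by rewrite /= fg.
have sandwich h : h ≈ a B ∘ fmap (fcomp G F) h ∘ b A.
  by rewrite nat -hcompA (proj2 (ab A)) hcompf1.
by rewrite (sandwich f) fg -sandwich.
Qed.

End Equivalence.

(** The preimage is [G h] conjugated by the unit. As [G] is faithful, it is enough to compare images
    under [G], where naturality applies. *)
Lemma equiv_full C D (F : functor C D) (G : functor D C) (A B : C)
    (h : hom D (F A) (F B)) :
  inverse_functors F G -> exists f, fmap F f ≈ h.
Proof.
move=> FG; have [[a [b [ab nat]]] _] := FG.
exists (a B ∘ fmap G h ∘ b A); apply: (equiv_faithful (inverse_functors_sym FG)).
set f := a B ∘ _ ∘ _.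
have -> : fmap G (fmap F f) ≈ b B ∘ (a B ∘ fmap (fcomp G F) f).
  by rewrite hcompA (proj1 (ab B)) hcomp1f.
rewrite nat /f /= -!hcompA (proj1 (ab A)) hcompf1 hcompA (proj1 (ab B)).
by rewrite hcomp1f.
Qed.

(** The universal properties are tested on objects [Y] of [D]; each is replaced by the isomorphic
    [F (G Y)], so that morphisms lift to [C] by fullness and equations by faithfulness. *)
Lemma equiv_short_exact C D (F : functor C D) (G : functor D C) (A B X : C)
    (f : hom C A B) (g : hom C B X) :
  inverse_functors F G -> short_exact f g -> short_exact (fmap F f) (fmap F g).
Proof.
move=> FG [[gf0 ker] [_ cok]].
have faithful A' B' := @equiv_faithful C D F G FG A' B'.
have full A' B' (h : hom D (F A') (F B')) := equiv_full h FG.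
split; split; try by rewrite -fmap_comp gf0 fmap0.
- move=> Y h gh0; have [e [e' [e'e ee']]] := equiv_counit FG Y.
  have [h' hh'] := full _ _ (h ∘ e).
  have [|u [fu uniq]] := ker _ h'.
    by apply: faithful; rewrite fmap_comp hh' hcompA gh0 hcomp0l fmap0.
  exists (fmap F u ∘ e'); split=> [|v fv].
    by rewrite hcompA -fmap_comp fu hh' -hcompA ee' hcompf1.
  have [v' vv'] := full _ _ (v ∘ e).
  rewrite -(uniq v') ?vv'; first by rewrite -hcompA ee' hcompf1.
  by apply: faithful; rewrite fmap_comp vv' hcompA fv hh'.
- move=> Y h hf0; have [e [e' [e'e ee']]] := equiv_counit FG Y.
  have [h' hh'] := full _ _ (e' ∘ h).
  have [|u [ug uniq]] := cok _ h'.
    by apply: faithful; rewrite fmap_comp hh' -hcompA hf0 hcomp0r fmap0.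
  exists (e ∘ fmap F u); split=> [|v vg].
    by rewrite -hcompA -fmap_comp ug hh' hcompA ee' hcomp1f.
  have [v' vv'] := full _ _ (e' ∘ v).
  rewrite -(uniq v') ?vv'; first by rewrite hcompA ee' hcomp1f.
  by apply: faithful; rewrite fmap_comp vv' -hcompA vg hh'.
Qed.

(** A section of the image extension lifts by fullness. With [G] in place of [F], the lemma serves
    to push vanishing forward. *)
Lemma equiv_ext1_zeroW C D (F : functor C D) (G : functor D C) (X A : C) :
  inverse_functors F G -> ext1_zero (F X) (F A) -> ext1_zero X A.
Proof.
move=> FG ext B f g /(equiv_short_exact FG)/ext[s gs].
have [t ts] := equiv_full s FG; exists t; apply: (equiv_faithful FG).
by rewrite fmap_comp ts fmap1.
Qed.

(** [G] pulls a decomposition of [F A] back to one of [A]; vanishing returns because [Z] is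
    isomorphic to [F (G Z)]. *)
Lemma equiv_indecomposable C D (F : functor C D) (G : functor D C) (A : C) :
  inverse_functors F G -> indecomposable A -> indecomposable (F A).
Proof.
move=> FG [A0 indA]; have GF := inverse_functors_sym FG.
split=> [/(functor_is_zero G)/(is_zero_iso (equiv_unit FG A))//|X Y FAXY].
have zeroW Z : is_zero (G Z) -> is_zero Z.
  by move/(functor_is_zero F); apply/is_zero_iso/equiv_counit.
have /indA[] : direct_sum2 A (G X) (G Y).
  apply: direct_sum2_iso (functor_direct_sum2 G FAXY); try exact: iso_refl.
  exact: equiv_unit.
- by left; apply: zeroW.
- by right; apply: zeroW.
Qed.

Lemma equiv_tilting C D (F : functor C D) (G : functor D C) (T : C) :
  inverse_functors F G -> tilting T -> tilting (F T).
Proof.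
move=> FG [[n [A [indA nisoA sumA]]] extT genT].
have GF := inverse_functors_sym FG.
have unitX X : iso X (G (F X)) by apply/iso_sym/equiv_unit.
have counit X : iso X (F (G X)) by apply/iso_sym/equiv_counit.
split.
- exists n, (fun i => F (A i)); split=> [i|i j ij FAij|].
  + exact: equiv_indecomposable FG (indA i).
  + apply: nisoA ij (iso_trans (unitX _) (iso_trans _ (iso_sym (unitX _)))).
    exact: functor_iso.
  + exact: functor_direct_sum.
- by apply: (equiv_ext1_zeroW GF); apply: ext1_zero_iso extT.
- move=> X homX extX.
  (* The generating property of [T] is applied to [G X], whose vanishing forces that of [X]. *)
  suff GX0 : is_zero (G X).
    exact: is_zero_iso (iso_sym (counit X)) (functor_is_zero F GX0).
  apply: genT => [f|].
    have [e [e' [e'e ee']]] := iso_sym (counit X).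
    apply: (equiv_faithful FG).
    by rewrite -(hcomp1f (fmap F f)) -e'e -hcompA (homX (e ∘ _)) hcomp0r fmap0.
  apply: (equiv_ext1_zeroW FG); apply: ext1_zero_iso extX => //.
  exact: iso_refl.
Qed.

End LinearCategories.

(** * Shifts and [sigma12] on line bundles *)

Section Sheaves.
Local Set Implicit Arguments.
Local Unset Strict Implicit.
Local Open Scope cat_scope.
Local Open Scope ring_scope.
Variables (k : closedFieldType) (p q : nat).
Local Notation O x := (line_bundle k (x : L p q)).
Local Notation deg i j := (x1 p q *~ i - x2 p q *~ j).
Implicit Types (T : coh k p q) (F : selfequiv (coh k p q)).

Lemma shift_line_bundle (x y : L p q) : iso (shift k x (O y)) (O (x + y)).
Proof. exact: natiso_iso (shiftD k erefl). Qed.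

Lemma swapLMn (pq : p = q) (y : L p q) n : swapL (y *+ n) = swapL y *+ n.
Proof.
elim: n => [|n IH]; last by rewrite !mulrS swapLD // IH.
by apply: (addrI (swapL 0)); rewrite mulr0n -swapLD // !addr0.
Qed.

Lemma swapLN (pq : p = q) (y : L p q) : swapL (- y) = - swapL y.
Proof.
by apply: (addrI (swapL y)); rewrite -swapLD // !subrr (swapLMn pq 0 0).
Qed.

(** Exchanging the variables becomes linear once the scalars on one side are twisted by the same
    exchange; being an involution, it is its own inverse. *)
Lemma sigma_structure_sheaf (pq : p = q) :
  iso (sigma12 k pq (structure_sheaf k p q)) (structure_sheaf k p q).
Proof.
(* Exchanging exponents exchanges the two generators in the degree, which makes [swapS] compatible
   with the twisted grading. *)
have deg_swap (m : 'X_{1..2}) :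
    @degL p q [multinom m (tperm ord0 ord_max i) | i < 2] =
    swapL (@degL p q m).
  rewrite /degL swapLD // !swapLMn // swapL_x1 // swapL_x2 //.
  by rewrite !mnmE tpermL tpermR addrC.
have swap_part x (f : {mpoly k[2]}) :
    swapS (Spart (swapL x) f : {mpoly k[2]}) = Spart (x : L p q) (swapS f).
  apply/mpolyP => m; rewrite mcoeff_sym !mcoeff_Spart mcoeff_sym deg_swap.
  by rewrite (inj_eq (inv_inj (swapLK pq))).
pose N := smod (sigma12 k pq (structure_sheaf k p q)).
pose M := Sgr k p q.
have swapD : {morph @swapS k : f g / f + g} by move=> f g; apply: rmorphD.
have swapM : {morph @swapS k : f g / f * g} by move=> f g; apply: rmorphM.
have swapZ : forall (f : {mpoly k[2]}) (m : N),
    (swapS (f *: m : N) : M) = f *: (swapS m : M).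
  by move=> f m; rewrite -{2}[f]swapSK; apply: swapM.
have swapZ' : forall (f : {mpoly k[2]}) (m : M),
    (swapS (f *: m : M) : N) = f *: (swapS m : N).
  by move=> f m; apply: swapM.
have swap_part' x (f : {mpoly k[2]}) :
    swapS (Spart (x : L p q) f : {mpoly k[2]}) = Spart (swapL x) (swapS f).
  by rewrite -swap_part swapLK.
exists (@qfun _ _ _ N M (@swapS k) swapD swapZ swap_part).
exists (@qfun _ _ _ M N (@swapS k) swapD swapZ' swap_part').
by split; apply: qeq_incl => m n [l /= -> ->]; rewrite swapSK.
Qed.

Lemma sigma_line_bundle (pq : p = q) (x : L p q) :
  iso (sigma12 k pq (O x)) (O (swapL x)).
Proof.
apply: iso_trans (natiso_iso (structure_sheaf k p q) (sigma_shift k pq x)) _.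
exact (functor_iso (shift k (swapL x)) (sigma_structure_sheaf pq)).
Qed.

Lemma selfequiv_tilting_bundle F (h : L p q -> L p q) T :
    (forall x, iso (F (O x)) (O (h x))) ->
  tilting_bundle T -> tilting_bundle (F T).
Proof.
move=> FO [tiltT [n [x sumT]]]; have [G FG] := se_inv F; split.
  exact: equiv_tilting FG tiltT.
exists n, (h \o x); apply: direct_sum_iso (functor_direct_sum F sumT) => //.
exact: iso_refl.
Qed.

(** * Arcs and third vertices *)

Lemma Gamma_arcP T (i j : int) : (0 < p)%N -> (0 < q)%N ->
  Gamma T (lower q j, upper p i) -> summand (O (deg i j)) T.
Proof.
move=> p_gt0 q_gt0 [i' [j' [[eq_j eq_i] T_O]]].
(* A marked point determines its numerator, because its denominator is nonzero. *)
have div_inj n : (0 < n)%N -> injective (fun a : int => a%:~R / n%:R : rat).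
  move=> n_gt0 a b /mulIf eq_ab; apply: (@intr_inj rat); apply: eq_ab.
  by rewrite invr_eq0 pnatr_eq0 -lt0n.
by rewrite (div_inj _ q_gt0 _ _ eq_j) (div_inj _ p_gt0 _ _ eq_i).
Qed.

(** The degree equation lives in [L p q], so the new indices may be normalised by [p x1 = q x2], as
    the wrap-around of [r1] requires. *)
Lemma selfequiv_Gamma F (h : L p q -> L p q) T (i j i' j' : int) :
    (0 < p)%N -> (0 < q)%N -> (forall x, iso (F (O x)) (O (h x))) ->
    h (deg i j) = deg i' j' ->
  Gamma T (lower q j, upper p i) -> Gamma (F T) (lower q j', upper p i').
Proof.
move=> p_gt0 q_gt0 FO hij /(Gamma_arcP p_gt0 q_gt0) T_O.
exists i', j'; split=> //.
apply: summand_iso (functor_summand F T_O); last exact: iso_refl.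
by rewrite -hij.
Qed.

(** On arcs this is the half turn [rotate]: the ends are exchanged and both indices change sign. *)
Lemma swapL_deg (pq : p = q) (i j : int) :
  swapL (deg i j) = deg (- j) (- i).
Proof.
have swapMz (y : L p q) a : swapL (y *~ a) = swapL y *~ a.
  by case: a => n; rewrite ?NegzE ?mulrNz ?swapLN // -!pmulrn swapLMn.
rewrite swapLD // swapLN // !swapMz swapL_x1 // swapL_x2 //.
by rewrite !mulrNz opprK addrC.
Qed.

(** Adding [x1] keeps the lower end of an arc and moves the upper end one step right, so each
    triangle passes to the next segment. The last triangle leaves the range; the unit translation
    that brings it back lowers the index of its third vertex by [q]. *)
Lemma r1_third_vertices F T (c : seq int) : (0 < q)%N -> size c = p ->
    natiso F (shift k (x1 p q)) -> third_vertices p q (Gamma T) c ->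
  third_vertices p q (Gamma (F T)) (belast (last 0 c - q%:Z) c).
Proof.
move=> q_gt0 size_c Fr1 Tc i lt_ip; have p_gt0 : (0 < p)%N by lia.
have FO x : iso (F (O x)) (O (x1 p q + x)).
  exact: iso_trans (natiso_iso _ Fr1) (shift_line_bundle _ _).
have move_arc := selfequiv_Gamma p_gt0 q_gt0 FO.
(* [belast] only drops the final entry, so below index [p] the full list can be read instead. *)
have -> : (belast (last 0 c - q%:Z) c)`_i = (last 0 c - q%:Z :: c)`_i.
  by rewrite lastI nth_rcons size_belast size_c lt_ip.
case: i lt_ip => [_|i lt_ip] /=.
  (* With entries numbered from 0, the new first triangle is the old last one, at index [p.-1]. *)
  have [Tl Tr] := Tc p.-1 ltac:(lia).
  have wrap a : x1 p q *~ p - x2 p q *~ a = - (x2 p q *~ (a - q%:Z)).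
    by rewrite -!pmulrn x1x2 mulrzBr opprB -pmulrn.
  rewrite -nth_last size_c.
  split; [move: Tl|move: Tr]; apply: move_arc.
    by rewrite addrA -pmulrn -mulrS prednK // pmulrn wrap mulr0z add0r.
  by rewrite prednK // wrap mulr1z.
have [Tl Tr] := Tc i ltac:(lia).
by split; [move: Tl|move: Tr]; apply: move_arc; rewrite addrA -!pmulrn -mulrS.
Qed.

(** The lower index enters the degree with a minus sign, so adding [x2] lowers it by one and keeps
    the upper end. *)
Lemma r2_third_vertices F T (c : seq int) : (0 < q)%N -> size c = p ->
    natiso F (shift k (x2 p q)) -> third_vertices p q (Gamma T) c ->
  third_vertices p q (Gamma (F T)) [seq a - 1 | a <- c].
Proof.
move=> q_gt0 size_c Fr2 Tc i lt_ip; have p_gt0 : (0 < p)%N by lia.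
have FO x : iso (F (O x)) (O (x2 p q + x)).
  exact: iso_trans (natiso_iso _ Fr2) (shift_line_bundle _ _).
have move_arc := selfequiv_Gamma p_gt0 q_gt0 FO.
have [Tl Tr] := Tc i lt_ip; rewrite (nth_map 0) ?size_c //.
by split; [move: Tl|move: Tr]; apply: move_arc;
  rewrite mulrzBr mulr1z opprB addrCA addrA.
Qed.

Lemma sigma_third_vertices (pq : p = q) F T (c : seq int) :
    natiso F (sigma12 k pq) -> third_vertices p q (rotate_arcs (Gamma T)) c ->
  third_vertices p q (Gamma (F T)) c.
Proof.
move=> Fsigma Tc i lt_ip; have p_gt0 : (0 < p)%N by lia.
have q_gt0 : (0 < q)%N by lia.
have FO x : iso (F (O x)) (O (swapL x)).
  exact: iso_trans (natiso_iso _ Fsigma) (sigma_line_bundle _ _).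
have unrotate D : rotate_arcs (Gamma T) D -> Gamma (F T) D.
  move=> [_ [[a [b [-> T_O]]] ->]]; exists (- b), (- a); split.
    rewrite /rotate /lower /upper /= subrr subr0 -!mulNr -!mulrNz.
    (* Rotation exchanges the denominators [p] and [q], which agree by [pq]. *)
    by congr ((_, _), (_, _)); congr (_ / _%:R).
  apply: summand_iso (functor_summand F T_O); last exact: iso_refl.
  by rewrite -swapL_deg.
by have [Tl Tr] := Tc i lt_ip; split; apply: unrotate.
Qed.

End Sheaves.

(** * From the generators to the whole group *)

Theorem theorem1p3 (k : closedFieldType) (p q : nat)
    (p_gt0 : (0 < p)%N) (le_pq : (p <= q)%N)
    (eta : Lambda p q -> coh k p q) (eta_phi : inverse_phi eta)
    (act : Htilde p q -> Lambda p q -> Lambda p q)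
    (actP : Lambda_action k act)
    (psi : Htilde p q -> selfequiv (coh k p q)) (psiP : Aut_morphism psi)
    (f : Htilde p q) (nu : Lambda p q) :
  iso (eta (act f nu)) (psi f (eta nu)).
Proof.
have q_gt0 : (0 < q)%N by apply: leq_trans le_pq.
have [phi_eta eta_of_phi] := eta_phi.
have [act1 actM act_r1 act_r2 act_sigma] := actP.
have [psiM psi_r1 psi_r2 psi_sigma] := psiP.
have size_coords (mu : Lambda p q) : size (coords mu) = p.
  exact: size_tuple (val mu).
pose good g := forall mu, iso (eta (act g mu)) (psi g (eta mu)).
(* [psi] is given as multiplicative only. Since [psi 1] is isomorphic to its own square, cancelling
   a factor with the quasi-inverse [G] shows that it fixes objects up to isomorphism. *)
have good1 : good 1%g.
  move=> mu; rewrite act1; have [G [GF _]] := se_inv (psi 1%g).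
  have := psiM 1%g 1%g; rewrite mulg1 => psi11.
  have unitX X := natiso_iso X GF.
  apply: iso_trans (iso_sym (unitX _)) _.
  apply: iso_trans (functor_iso G (natiso_iso (eta mu) psi11)) _.
  exact: unitX.
have goodM g h : good g -> good h -> good (g * h)%g.
  move=> good_g good_h mu; rewrite actM.
  apply: iso_trans (good_g _) _.
  apply: iso_trans (functor_iso (psi g) (good_h mu)) _.
  exact: iso_sym (natiso_iso (eta mu) (psiM g h)).
(* The hypothesis on [g] is used at [mu' = g^-1 mu], after splitting [psi 1] into [psi g^-1] and
   [psi g]. *)
have goodV g : good g -> good (g^-1)%g.
  move=> good_g mu; set mu' := act _ mu.
  have mu'E : mu = act g mu' by rewrite -actM mulgV act1.
  have := good1 mu'; rewrite act1 => id_mu'.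
  apply: iso_trans id_mu' _; rewrite -(mulVg g).
  apply: iso_trans (natiso_iso _ (psiM _ _)) _.
  have := functor_iso (psi (g^-1)%g) (iso_sym (good_g mu')).
  by rewrite -mu'E.
(* By the uniqueness half of [eta_phi], a tilting bundle is recognised by its value under [phi]. *)
have good_gen g (h : L p q -> L p q) :
    (forall x, iso (psi g (line_bundle k x)) (line_bundle k (h x))) ->
    (forall mu, phi (psi g (eta mu)) (act g mu)) -> good g.
  move=> psi_g phi_g mu; apply/iso_sym/eta_of_phi; last exact: phi_g.
  by apply: selfequiv_tilting_bundle psi_g _; have [] := phi_eta mu.
have good_r1 : good (r1 p q).
  apply: (good_gen _ (+%R (x1 p q))) => [x|mu].
    by apply: iso_trans (natiso_iso _ psi_r1) _; apply: shift_line_bundle.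
  rewrite /phi act_r1; apply: r1_third_vertices => //.
  by have [_] := phi_eta mu.
have good_r2 : good (r2 p q).
  apply: (good_gen _ (+%R (x2 p q))) => [x|mu].
    by apply: iso_trans (natiso_iso _ psi_r2) _; apply: shift_line_bundle.
  rewrite /phi act_r2; apply: r2_third_vertices => //.
  by have [_] := phi_eta mu.
have good_sigma : good (sigma p q).
  have [pq|neq_pq] := pselect (p = q); last first.
    (* For distinct weights the presentation itself kills [sigma]. *)
    have -> : sigma p q = 1%g by apply/hpiE/hcong_rel/hrel_triv.
    exact: good1.
  apply: (good_gen _ (@swapL p q)) => [x|mu].
    apply: iso_trans (natiso_iso _ (psi_sigma pq)) _.
    exact: sigma_line_bundle.
  have [tilt_mu phi_mu] := phi_eta mu.
  apply: sigma_third_vertices (psi_sigma pq) _.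
  exact: act_sigma.
suff : good f by apply.
(* Induction on a word in the generators and their inverses that represents [f]. *)
have [u ->] := hpiP f; elim: u => [|[g b] u IH]; first exact: good1.
have -> : hpi p q ((g, b) :: u) = (hpi p q [:: (g, b)] * hpi p q u)%g.
  by rewrite [RHS](hmulE _ _ [:: (g, b)] u).
apply: goodM IH.
have {b} [->|->] : hpi p q [:: (g, b)] = hpi p q (wgen g) \/
    hpi p q [:: (g, b)] = ((hpi p q (wgen g))^-1)%g.
- by case: b; [left|right; rewrite [RHS]hinvE].
- by case: g.
- by apply: goodV; case: g.
Qed.
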